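(* Let $n\geqslant 2$, let $D, D'\subset\mathbb{R}^n$ be domains such that $\overline{D}$ and $\overline{D'}$ are compact subsets of $\mathbb{R}^n$, and let $Q:\mathbb{R}^n\to[0,\infty]$ be a Lebesgue measurable function with $Q(x)\in[1,\infty]$ for $x\in D$ and $Q(x)=0$ for $x\notin D$. If $Q\in L^1(D)$, then the family $\mathfrak{R}_Q(D,D')$ is equicontinuous in $D'$ (that is, equicontinuous at every point of $D'$ with respect to the Euclidean metric).
   Context: A domain is a nonempty open connected subset of $\mathbb{R}^n$; $dm$ denotes Lebesgue measure in $\mathbb{R}^n$. For a family $\Gamma$ of paths in $\mathbb{R}^n$, a Borel function $\rho:\mathbb{R}^n\to[0,\infty]$ is called admissible, written $\rho\in\mathrm{adm}\,\Gamma$, if $\int_\gamma \rho(x)\,|dx|\geqslant 1$ for every (locally rectifiable) $\gamma\in\Gamma$. The modulus of $\Gamma$ is $M(\Gamma)=\inf_{\rho\in\mathrm{adm}\,\Gamma}\int_{\mathbb{R}^n}\rho^n(x)\,dm(x)$ (equal to $\infty$ if $\mathrm{adm}\,\Gamma=\varnothing$). For a mapping $f$, $f(\Gamma)=\{f\circ\gamma:\gamma\in\Gamma\}$. The family $\mathfrak{R}_Q(D,D')$ consists of all mappings $g:D'\to D$ such that $f=g^{-1}$ is a homeomorphism of $D$ onto $D'$ satisfying, for every family $\Gamma$ of paths in $D$, $$M(f(\Gamma))\leqslant\int_D Q(x)\,\rho^n(x)\,dm(x)\qquad\text{for all }\rho\in\mathrm{adm}\,\Gamma.$$ *)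

(* Defs.v *)
From HB Require Import structures.
From mathcomp Require Import all_boot all_order all_algebra.
From mathcomp Require Import all_classical all_reals all_analysis.
From mathcomp Require Import measurable_realfun.

Set Implicit Arguments.
Unset Strict Implicit.
Unset Printing Implicit Defensive.

Import Order.TTheory GRing.Theory Num.Theory.
Import numFieldNormedType.Exports.

Local Open Scope classical_set_scope.
Local Open Scope ring_scope.

(* R^n is 'rV[R]_n. Its library norm is the sup norm, which induces the usual
   topology; all metric notions (length of paths, equicontinuity) go through
   the Euclidean norm enorm. *)
Definition enorm (R : realType) (n : nat) (x : 'rV[R]_n) : R :=
  Num.sqrt (\sum_(i < n) x 0 i ^+ 2).

Section LebesgueMeasure.
Context (R : realType) (n : nat).
Local Open Scope ereal_scope.

Definition box (p : 'rV[R]_n * 'rV[R]_n) : set 'rV[R]_n :=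
  [set x | forall i, (p.1 0 i <= x 0 i <= p.2 0 i)%R].

Definition box_vol (p : 'rV[R]_n * 'rV[R]_n) : R :=
  \prod_(i < n) Num.max 0%R (p.2 0 i - p.1 0 i)%R.

(* The index set KF.1 makes finite and empty covers available, so that the outer
   measure of set0 is 0 also for n = 0. *)
Definition box_cover (A : set 'rV[R]_n)
    (KF : set nat * (nat -> 'rV[R]_n * 'rV[R]_n)) : Prop :=
  A `<=` \bigcup_(k in KF.1) box (KF.2 k).

Definition lebesgue_outer (A : set 'rV[R]_n) : \bar R :=
  ereal_inf [set \esum_(k in KF.1) (box_vol (KF.2 k))%:E
            | KF in box_cover A].

Lemma box_vol_ge0 p : (0 <= (box_vol p)%:E).
Proof. by rewrite lee_fin; apply: prodr_ge0 => i _; rewrite le_max lexx. Qed.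

Lemma lebesgue_outer_ge0 A : 0 <= lebesgue_outer A.
Proof.
apply: le_ereal_inf_tmp => _ [KF _ <-].
by apply: esum_ge0 => k _; exact: box_vol_ge0.
Qed.

Lemma lebesgue_outer0 : lebesgue_outer set0 = 0.
Proof.
apply/eqP; rewrite eq_le lebesgue_outer_ge0 andbT.
apply: ereal_inf_lbound; exists (set0, fun=> (0%R, 0%R)) => //=.
by rewrite esum_set0.
Qed.

Lemma le_lebesgue_outer : {homo lebesgue_outer : A B / A `<=` B >-> A <= B}.
Proof.
move=> A B AB; apply: ereal_inf_le_tmp => _ [KF BKF <-].
by exists KF => //; exact: subset_trans BKF.
Qed.

Lemma lebesgue_outer_sigma_subadditive : sigma_subadditive lebesgue_outer.
Proof.
move=> A; have [[i ioo]|] := pselect (exists i, lebesgue_outer (A i) = +oo).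
  rewrite (eseries_pinfty _ _ ioo) ?leey// => k _.
  by rewrite -ltNye (lt_le_trans _ (lebesgue_outer_ge0 _)).
rewrite -forallNE => Aoo.
apply/lee_addgt0Pr => e e0.
rewrite (le_trans _ (epsilon_trick _ _ (ltW e0)))//; last first.
  by move=> k; exact: lebesgue_outer_ge0.
have /choice[G PG] m : exists KF, box_cover (A m) KF /\
    \esum_(k in KF.1) (box_vol (KF.2 k))%:E
      <= lebesgue_outer (A m) + (e / (2 ^ m.+1)%:R)%:E.
  have em : (0 < e / (2 ^ m.+1)%:R)%R by rewrite divr_gt0.
  have Afin : lebesgue_outer (A m) \is a fin_num.
    by rewrite ge0_fin_numE ?lebesgue_outer_ge0// ltey; exact/eqP/Aoo.
  have [_ [KF AKF <-] KFlt] := lb_ereal_inf_adherent em Afin.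
  by exists KF; split => //; exact: ltW.
pose J := [set: nat] `*`` (fun m => (G m).1).
pose v (p : nat * nat) := (box_vol ((G p.1).2 p.2))%:E.
apply: (@le_trans _ _ (\esum_(p in J) v p)).
  apply: ereal_inf_lbound.
  exists ([set k | exists2 p, J p & pickle p = k],
      fun k => if unpickle k is Some p then (G p.1).2 p.2 else (0%R, 0%R)).
    move=> x [m _ Amx]; have [k Gk xk] := (PG m).1 x Amx.
    by exists (pickle (m, k)) => /=; [exists (m, k)|rewrite pickleK].
  rewrite (@reindex_esum _ _ _ J _ pickle) /=; last first.
    split=> [p Jp|p q _ _|_ [p Jp <-]]; [by exists p| |by exists p].
    exact/(pcan_inj pickleK).
  by apply: eq_esum => p _; rewrite pickleK.
rewrite -(esum_esum (a := fun m k => (box_vol ((G m).2 k))%:E)); last first.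
  by move=> *; exact: box_vol_ge0.
rewrite -nneseries_esumT; last first.
  by move=> m; apply: esum_ge0 => k _; exact: box_vol_ge0.
apply: lee_nneseries => [m _ _|m _]; last exact: (PG m).2.
by apply: esum_ge0 => k _; exact: box_vol_ge0.
Qed.

HB.instance Definition _ := isOuterMeasure.Build R 'rV[R]_n lebesgue_outer
  lebesgue_outer0 lebesgue_outer_ge0 le_lebesgue_outer
  lebesgue_outer_sigma_subadditive.

End LebesgueMeasure.

Definition lebesgue_outer_measure (R : realType) (n : nat) :
  {outer_measure set 'rV[R]_n -> \bar R} := @lebesgue_outer R n.

(* R^n with its Lebesgue (Caratheodory) sigma-algebra, and with its Borel
   sigma-algebra; both carriers are convertible to 'rV[R]_n. *)
Definition lebesgueRn (R : realType) (n : nat) :=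
  caratheodory_type (lebesgue_outer_measure R n).

Definition borelRn (R : realType) (n : nat) :=
  g_sigma_algebraType (@open 'rV[R]_n).

Definition lebesgue (R : realType) (n : nat) :
    {measure set (lebesgueRn R n) -> \bar R} :=
  (lebesgue_outer_measure R n
    : set (caratheodory_type (lebesgue_outer_measure R n)) -> \bar R).

Definition domain (R : realType) (n : nat) (D : set 'rV[R]_n) : Prop :=
  [/\ D !=set0, open D & connected D].

Section Modulus.
Context (R : realType) (n : nat).

(* A path is a continuous map of a nonempty interval (open, closed, half-open,
   bounded or not) into R^n; values outside the interval are irrelevant. *)
Definition rpath : Type := (interval R * (R -> 'rV[R]_n))%type.

Definition is_path (g : rpath) : Prop :=
  [set` g.1] !=set0 /\ {within [set` g.1], continuous g.2}.

Definition path_in (D : set 'rV[R]_n) (g : rpath) : Prop :=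
  is_path g /\ forall t, t \in g.1 -> D (g.2 t).

Definition arc_length (c : R -> 'rV[R]_n) (a b : R) : \bar R :=
  ereal_sup [set (\sum_(0 <= k < size s)
      enorm (c (nth b (a :: s) k.+1) - c (nth b (a :: s) k)))%:E
    | s in itv_partition a b].

Definition locally_rectifiable (g : rpath) : Prop :=
  forall a b, a <= b -> a \in g.1 -> b \in g.1 ->
    (arc_length g.2 a b < +oo)%E.

(* The arc length parametrization of c on [a, b]: the point of c reached at
   arc length u. It does not depend on the chosen parameter t, since c is
   constant wherever its arc length function is. *)
Definition arc_param (c : R -> 'rV[R]_n) (a b u : R) : 'rV[R]_n :=
  c (xget a [set t | a <= t <= b /\ arc_length c a t = u%:E]).

Definition arc_integral (rho : 'rV[R]_n -> \bar R) (c : R -> 'rV[R]_n)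
    (a b : R) : \bar R :=
  (\int[lebesgue_measure]_(u in `[0%R, fine (arc_length c a b)])
     rho (arc_param c a b u))%E.

(* Integral of rho >= 0 with respect to |dx| along a locally rectifiable path:
   the supremum over its closed subpaths. *)
Definition path_integral (rho : 'rV[R]_n -> \bar R) (g : rpath) : \bar R :=
  ereal_sup [set arc_integral rho g.2 ab.1 ab.2
            | ab in [set ab : R * R |
                [/\ ab.1 <= ab.2, ab.1 \in g.1 & ab.2 \in g.1]]].

Definition adm (Gamma : set rpath) : set ('rV[R]_n -> \bar R) :=
  [set rho | [/\ forall x, (0 <= rho x)%E,
      measurable_fun [set: borelRn R n] (rho : borelRn R n -> \bar R)
    & forall g, Gamma g -> locally_rectifiable g ->
        (1 <= path_integral rho g)%E]].

Definition modulus (Gamma : set rpath) : \bar R :=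
  ereal_inf [set (\int[lebesgue R n]_x (rho x ^+ n))%E | rho in adm Gamma].

Definition path_image (f : 'rV[R]_n -> 'rV[R]_n) (Gamma : set rpath) :
    set rpath :=
  [set (g.1, f \o g.2) | g in Gamma].

(* f restricts to a homeomorphism of D onto D' with inverse g. *)
Definition homeo_with_inverse (D D' : set 'rV[R]_n)
    (f g : 'rV[R]_n -> 'rV[R]_n) : Prop :=
  [/\ set_fun D D' f /\ set_fun D' D g,
      (forall x, D x -> g (f x) = x) /\ (forall y, D' y -> f (g y) = y),
      {within D, continuous f} & {within D', continuous g}].

(* Mappings D' -> D are represented by total functions, only their values on
   D' being relevant. *)
Definition R_Q (Q : 'rV[R]_n -> \bar R) (D D' : set 'rV[R]_n) :
    set ('rV[R]_n -> 'rV[R]_n) :=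
  [set g | exists f, homeo_with_inverse D D' f g /\
    forall Gamma : set rpath, (forall c, Gamma c -> path_in D c) ->
      forall rho, adm Gamma rho ->
        (modulus (path_image f Gamma)
          <= \int[lebesgue R n]_(x in D) (Q x * rho x ^+ n))%E].

Definition equicontinuous_in (D : set 'rV[R]_n)
    (F : set ('rV[R]_n -> 'rV[R]_n)) : Prop :=
  forall x0, D x0 -> forall e : R, 0 < e -> exists2 d : R, 0 < d &
    forall g, F g -> forall x, D x ->
      enorm (x - x0) < d -> enorm (g x - g x0) < e.

End Modulus.

(* Main.v *)
From HB Require Import structures.
Require Import Defs.
From mathcomp Require Import all_boot all_order all_algebra.
From mathcomp Require Import all_classical all_reals all_analysis.
From mathcomp Require Import measurable_realfun lra ring.

(** Fix y0 in D' and suppose that a mapping g of the family moves a point y1 very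
    close to y0 to a point g y1 at distance at least e from g y0. Consider the
    two rays issued from g y1 and from g y0 that point away from each other.
    Since D is bounded, each ray leaves D, and its image by f = g^-1, before
    the ray leaves D, is a connected set that leaves a fixed cube around y0
    contained in D' (ray_image_leaves_cube). So both images meet every sphere
    centred at y0 whose radius lies between the distance from y0 to y1 and a
    fixed number. On the other hand the constant function 1 / e is admissible
    for the paths in D that have two points at distance at least e, so the
    integrability of Q and the defining inequality of the family bound the
    modulus of the images of these paths by a number K that does not depend
    on g.

    The contradiction is that a family of paths joining two such connected
    sets has a modulus that tends to infinity as y1 tends to y0. Concretely
    (exists_short_broken_line), if the integral of rho^n is at most K, there
    are points x and y in the two sets and a broken line x, z, y, close to y0,
    along which the integral of rho is less than 1. Its image by g is a path in
    D between points of the two rays, so rho cannot be admissible.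

    To find the broken line, let P(u) be the integral of rho^n over the cube of
    radius u around y0. Among many concentric annuli of fixed ratio, one has a
    small mass of rho^n. In it there is a radius s such that the increment of P
    over [s - r, s + r] is at most of the order of the square root of r, times
    that small mass (exists_holder_point: a nondecreasing function has such
    points). Take x and y on the sphere of radius s. Averaged over the
    apex z in a small cube, the integral of rho on the segment from x to z is an
    integral of averages of rho over cubes shrinking to x; the exponent n of
    the modulus is critical for such averages, and the decay of the mass
    around the sphere of radius s makes their sum converge
    (cone_integral_bound). Hence some apex works for x and y at once
    (exists_short_apex). The cube of apices is placed so that no segment comes
    near y0, and so remains in the annulus; this is possible in dimension at
    least 2 (exists_apex_direction).

    Cubes, spheres and annuli are those of the sup norm; lengths of paths and
    the displacement of g are Euclidean. *)

Set Implicit Arguments.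
Unset Strict Implicit.
Unset Printing Implicit Defensive.

Import Order.TTheory GRing.Theory Num.Theory.
Import numFieldNormedType.Exports.

Local Open Scope classical_set_scope.
Local Open Scope ring_scope.

(** * Lebesgue measure: Borel sets and affine maps *)

Section LebesgueRn.
Context (R : realType) (n : nat).
Local Notation V := 'rV[R]_n.
Local Notation aff a v := (fun z : V => (a *: z + v)%R).
Implicit Types (x y z v : V) (A B : set V) (a : R).

Definition set_coord x (i : 'I_n) (c : R) : V := \row_j if j == i then c else x 0 j.

Lemma set_coord_same x i c : set_coord x i c 0 i = c.
Proof. by rewrite mxE eqxx. Qed.

Lemma set_coord_other x i c j : j != i -> set_coord x i c 0 j = x 0 j.
Proof. by rewrite mxE => /negbTE ->. Qed.

(** A hyperplane orthogonal to a coordinate axis cuts a box into two boxes; when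
    it misses the box, the maximum with 0 in the volume absorbs the empty half. *)
Lemma box_vol_split (p : V * V) (i : 'I_n) (c : R) :
  box_vol (p.1, set_coord p.2 i (Num.min (p.2 0 i) c)) +
  box_vol (set_coord p.1 i (Num.max (p.1 0 i) c), p.2) = box_vol p.
Proof.
rewrite /box_vol (bigD1 i)//= [X in _ + X](bigD1 i)//= [RHS](bigD1 i)//=.
rewrite !set_coord_same.
have -> : \prod_(j < n | j != i) Num.max 0
    (set_coord p.2 i (Num.min (p.2 0 i) c) 0 j - p.1 0 j) =
  \prod_(j < n | j != i) Num.max 0 (p.2 0 j - p.1 0 j).
  by apply: eq_bigr => j ji; rewrite set_coord_other.
have -> : \prod_(j < n | j != i) Num.max 0
    (p.2 0 j - set_coord p.1 i (Num.max (p.1 0 i) c) 0 j) =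
  \prod_(j < n | j != i) Num.max 0 (p.2 0 j - p.1 0 j).
  by apply: eq_bigr => j ji; rewrite set_coord_other.
rewrite -mulrDl; congr (_ * _).
rewrite /Num.max /Num.min; repeat case: ifPn; rewrite -?leNgt; lra.
Qed.

(** Cutting every box of a cover along the bounding hyperplane gives covers of
    the two parts of the covered set with the same total volume. *)
Lemma measurable_halfspace (i : 'I_n) (c : R) :
  measurable ([set x | x 0 i < c] : set (lebesgueRn R n)).
Proof.
suff : (lebesgue_outer_measure R n).-caratheodory [set x | x 0 i < c] by [].
apply: le_caratheodory_measurable => X.
apply: le_ereal_inf_tmp => _ [KF cX <-].
pose G (k : nat) := ((KF.2 k).1, set_coord (KF.2 k).2 i (Num.min ((KF.2 k).2 0 i) c)).
pose H (k : nat) := (set_coord (KF.2 k).1 i (Num.max ((KF.2 k).1 0 i) c), (KF.2 k).2).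
rewrite (_ : \esum_(k in KF.1) _ = (\esum_(k in KF.1) (box_vol (G k))%:E +
  \esum_(k in KF.1) (box_vol (H k))%:E)%E); last first.
  rewrite -esumD; last 2 first.
  - by move=> *; exact: box_vol_ge0.
  - by move=> *; exact: box_vol_ge0.
  by apply: eq_esum => k _; rewrite -EFinD box_vol_split.
apply: leeD; apply: ereal_inf_lbound.
- exists (KF.1, G) => // x [Xx /= xc]; have [k Fk xk] := cX _ Xx.
  exists k => // j; have /= /andP[xk1 xk2] := xk j.
  rewrite xk1 /=; have [->|ji] := eqVneq j i; last by rewrite set_coord_other.
  by rewrite set_coord_same le_min (ltW xc) andbT; have /andP[] := xk i.
- exists (KF.1, H) => // x [Xx /= /negP]; rewrite -leNgt => xc.
  have [k Fk xk] := cX _ Xx.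
  exists k => // j; have /= /andP[xk1 xk2] := xk j.
  rewrite xk2 andbT; have [->|ji] := eqVneq j i; last by rewrite set_coord_other.
  by rewrite set_coord_same ge_max xc andbT; have /andP[] := xk i.
Qed.

Lemma measurable_coord (i : 'I_n) :
  measurable_fun [set: lebesgueRn R n] (fun x : lebesgueRn R n => (x : V) 0 i).
Proof.
apply: (measurability _ (RGenInftyO.measurableE R)) => //.
move=> _ [_ [a ->] <-]; rewrite setTI.
rewrite (_ : _ @^-1` _ = [set x : V | x 0 i < a]).
  exact: measurable_halfspace.
by apply/seteqP; split=> x /=; rewrite in_itv.
Qed.

(** A ball of the sup norm is a finite intersection of coordinate conditions,
    and every open set is the union of the countably many balls with rational
    centre and radius that it contains. *)
Lemma measurable_rV d (T : measurableType d) (f : T -> V) :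
  (forall i, measurable_fun [set: T] (fun t => f t 0 i)) ->
  measurable_fun [set: T] (f : T -> borelRn R n).
Proof.
move=> mf; apply: (@measurability _ _ _ (borelRn R n) _ _ (@open V)) => //.
move=> _ [U oU <-]; rewrite setTI.
pose c (q : 'rV[rat]_n * rat) := (map_mx ratr q.1 : V).
pose Q := [set q : 'rV[rat]_n * rat | ball (c q) (ratr q.2 : R) `<=` U].
rewrite (_ : _ @^-1` _ = \bigcup_(q in Q) (f @^-1` ball (c q) (ratr q.2))).
  rewrite bigcup_mkcond.
  apply: countable_bigcupT_measurable => [|q]; first exact: countableP.
  case: ifPn => // _.
  have [q0|q0] := leP (ratr q.2 : R) 0.
    rewrite (_ : _ @^-1` _ = set0)//.
    by rewrite -subset0 => t [/= q1 _]; move: q1; rewrite ltNge q0.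
  rewrite (_ : _ @^-1` _ = \bigcap_(i in [set: 'I_n])
      ((fun t => f t 0 i) @^-1` ball (c q 0 i) (ratr q.2))).
    apply: fin_bigcap_measurable => // i _.
    rewrite -[X in measurable X]setTI; apply: mf => //.
    exact: measurable_realfun.measurable_ball.
  apply/seteqP; split=> [t [_ ft] i _ /=|t ft]; first exact: ft.
  by split=> // i j; rewrite ord1; exact: ft.
apply/seteqP; split=> [t /= Uft|t [q Qq]]; last exact: Qq.
have /nbhs_ballP[e /= e0 eU] : nbhs (f t) U by exact: open_nbhs_nbhs.
have [r] := rat_in_itvoo (divr_gt0 e0 (ltr0n R 2)); rewrite in_itv/= => /andP[r0 re].
have /choice[p Pp] i : exists p : rat, ball (f t 0 i) (ratr r : R) (ratr p).
  have := @dense_rat R (ball (f t 0 i) (ratr r : R)).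
  case; [|exact: ball_open|by move=> y [fy [p _ py]]; exists p; rewrite py].
  by exists (f t 0 i); exact: ballxx.
exists (\row_i p i, r); last first.
  by split=> // i j; rewrite ord1 !mxE; apply: ball_sym; exact: Pp.
move=> x [/= _ cx]; apply: eU; split => // i j.
have := cx i j; rewrite ord1 !mxE => cxj.
apply: (@le_ball _ _ _ (ratr r + ratr r)); first by lra.
by apply: ball_triangle cxj; exact: Pp.
Qed.

Lemma measurable_id_borelRn :
  measurable_fun [set: lebesgueRn R n] (id : lebesgueRn R n -> borelRn R n).
Proof. by apply: measurable_rV; exact: measurable_coord. Qed.

Lemma borel_lebesgue_measurable B :
  measurable (B : set (borelRn R n)) -> measurable (B : set (lebesgueRn R n)).
Proof.
by move=> mB; rewrite -[B]setTI; exact: measurable_id_borelRn.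
Qed.

Lemma open_measurable_borelRn B : open B -> measurable (B : set (borelRn R n)).
Proof. by move=> oB; exact: sub_sigma_algebra. Qed.

Lemma closed_measurable_borelRn B :
  closed B -> measurable (B : set (borelRn R n)).
Proof.
move=> cB; rewrite -[B]setCK; apply: measurableC.
by apply: open_measurable_borelRn; exact: closed_openC.
Qed.

Lemma measurable_affine_comp d (T : measurableType d) (f : T -> R) (a b : R) :
  measurable_fun [set: T] f -> measurable_fun [set: T] (fun t => a * f t + b).
Proof.
by move=> mf; apply: measurable_funD => //; exact: measurable_funM.
Qed.

Lemma measurable_affine a v :
  measurable_fun [set: lebesgueRn R n]
    (aff a v : lebesgueRn R n -> borelRn R n).
Proof.
apply: measurable_rV => i.
under eq_fun do rewrite !mxE.
apply: measurable_affine_comp; exact: measurable_coord.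
Qed.

Lemma esumZl (I : set nat) (f : nat -> \bar R) (a : R) : 0 <= a ->
  (forall k, 0 <= f k)%E ->
  (\esum_(k in I) (a%:E * f k) = a%:E * \esum_(k in I) f k)%E.
Proof.
move=> a0 f0; rewrite esum_mkcond [in RHS]esum_mkcond.
have g0 k : (0 <= if k \in I then f k else 0)%E by case: ifP.
rewrite -!nneseries_esumT//; last by move=> k; case: ifP => // _; exact: mule_ge0.
rewrite -nneseriesZl//; apply: eq_eseriesr => k _.
by case: ifP; rewrite ?mule0.
Qed.

(** A homothety maps the boxes of a cover to boxes. Applied to the inverse
    homothety, this inequality is its own converse. *)
Lemma lebesgue_outer_preimage_le a v B : 0 < a ->
  (lebesgue_outer (aff a v @^-1` B) <=
    (a^-1 ^+ n)%:E * lebesgue_outer B)%E.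
Proof.
move=> a0.
have an0 : 0 < a^-1 ^+ n by rewrite exprn_gt0 ?invr_gt0.
rewrite -lee_pdivrMl//; apply: le_ereal_inf_tmp => _ [KF cB <-].
rewrite lee_pdivrMl// -esumZl ?(ltW an0)//; last by move=> k; exact: box_vol_ge0.
pose G k := (a^-1 *: ((KF.2 k).1 - v), a^-1 *: ((KF.2 k).2 - v)).
apply: ereal_inf_lbound; exists (KF.1, G); last first.
  apply: eq_esum => k _; rewrite -EFinM; congr EFin.
  rewrite -[n in a^-1 ^+ n]card_ord -prodr_const -big_split /=.
  apply: eq_bigr => i _; rewrite !mxE -mulrBr opprB addrA subrK.
  by rewrite maxr_pMr ?mulr0// invr_ge0 ltW.
move=> z Bz; have [k Fk xk] := cB _ Bz; exists k => // i.
have := xk i; rewrite !mxE => /andP[p1 p2]; apply/andP; split.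
  by rewrite mulrC ler_pdivrMr// lerBlDr mulrC.
by rewrite mulrC ler_pdivlMr// lerBrDr mulrC.
Qed.

Lemma lebesgue_outer_preimage a v B : 0 < a ->
  (lebesgue_outer (aff a v @^-1` B) =
    (a^-1 ^+ n)%:E * lebesgue_outer B)%E.
Proof.
move=> a0; apply/eqP; rewrite eq_le lebesgue_outer_preimage_le//=.
rewrite -{1}(_ : (fun z : V => a^-1 *: z - a^-1 *: v) @^-1`
  (aff a v @^-1` B) = B); last first.
  apply: eq_set => z; congr B.
  by rewrite scalerBr !scalerA divff ?gt_eqF// !scale1r subrK.
have an0 : 0 < a^-1 ^+ n by rewrite exprn_gt0 ?invr_gt0.
rewrite muleC -lee_pdivlMr// muleC.
apply: le_trans (lebesgue_outer_preimage_le _ _ _) _; first by rewrite invr_gt0.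
by rewrite invrK exprVn invrK.
Qed.

Lemma integral_affine a v B (f : V -> \bar R) : 0 < a ->
  measurable (B : set (borelRn R n)) ->
  measurable_fun [set: borelRn R n] (f : borelRn R n -> \bar R) ->
  (forall x, 0 <= f x)%E ->
  (\int[lebesgue R n]_(z in aff a v @^-1` B) f (a *: z + v)%R =
   (a^-1 ^+ n)%:E * \int[lebesgue R n]_(x in B) f x)%E.
Proof.
move=> a0 mB mf f0.
have an0 : 0 < a^-1 ^+ n by rewrite exprn_gt0 ?invr_gt0.
have mfB : measurable_fun (B : set (borelRn R n)) (f : borelRn R n -> \bar R).
  exact: measurable_funTS.
pose mu1 : {measure set borelRn R n -> \bar R} :=
  pushforward (lebesgue R n) (aff a v : lebesgueRn R n -> borelRn R n).
pose mu0 : {measure set borelRn R n -> \bar R} :=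
  pushforward (lebesgue R n) (id : lebesgueRn R n -> borelRn R n).
pose nu1 := mu1 (measurable_affine a v).
pose nu0 := mu0 measurable_id_borelRn.
pose k := NngNum (ltW an0).
transitivity (\int[nu1]_(x in B) (f : borelRn R n -> \bar R) x)%E.
  apply/esym; apply: (ge0_integral_pushforward (measurable_affine a v)) => //.
transitivity (\int[mscale k nu0]_(x in B) (f : borelRn R n -> \bar R) x)%E.
  by apply: eq_measure_integral => A mA _; exact: lebesgue_outer_preimage.
rewrite (ge0_integral_mscale nu0 mB k mfB)//; congr (_ * _)%E.
apply: (ge0_integral_pushforward measurable_id_borelRn) => //.
Qed.

Lemma lebesgue_outer_box_le (p : V * V) :
  (lebesgue_outer (box p) <= (box_vol p)%:E)%E.
Proof.
apply: ereal_inf_lbound; exists ([set 0%N], fun=> p).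
  by move=> x px; exists 0%N.
by rewrite esum_set1//; exact: box_vol_ge0.
Qed.
End LebesgueRn.

(** * Volume of cubes *)

Section Volume.
Context (R : realType) (n : nat).
Local Notation V := 'rV[R]_n.
Implicit Types (x y z v : V) (A B : set V) (a : R).

Lemma mx_norm_leP x a : 0 <= a -> reflect (forall i, `|x 0 i| <= a) (`|x| <= a).
Proof.
move=> a0; rewrite [`|x|]mx_normrE; apply: (iffP (bigmax_leP _ _ _ _)).
  by move=> [_ h] i; exact: (h (0, i)).
by move=> h; split => // -[j i] _; rewrite ord1; exact: h.
Qed.

Lemma coord_le_norm x i : `|x 0 i| <= `|x|.
Proof. exact: (mx_norm_leP x (normr_ge0 x) _). Qed.

Definition cube x a : set V := [set z | `|z - x| <= a].

Lemma cube_box x a : 0 <= a -> cube x a = box (x - const_mx a, x + const_mx a).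
Proof.
move=> a0; apply/seteqP; split => z.
  move=> /(mx_norm_leP _ a0) zx i; have := zx i.
  by rewrite !mxE ler_norml; lra.
move=> zx; apply/(mx_norm_leP _ a0) => i; have := zx i.
by rewrite !mxE ler_norml; lra.
Qed.

(** Integrate the number of boxes containing x, which is at least 1 on the unit
    cube, one coordinate at a time: after m integrations the indicators of the
    first m sides have been replaced by their lengths. This is what makes the
    Lebesgue measure of a cube positive. *)
Lemma unit_box_cover_vol (K : set nat) (p : nat -> V * V) :
  (forall x, (forall i, 0 <= x 0 i <= 1) -> exists2 k, K k & box (p k) x) ->
  (1 <= \esum_(k in K) (box_vol (p k))%:E)%E.
Proof.
move=> cov.
pose h m k x (i : 'I_n) : R := if (i < m)%N
  then Num.max 0 ((p k).2 0 i - (p k).1 0 i)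
  else \1_(`[(p k).1 0 i, (p k).2 0 i]%classic) (x 0 i).
have h_ge0 m k x i : 0 <= h m k x i.
  by rewrite /h; case: ifP => _; rewrite ?le_max ?lexx.
pose g m k x : \bar R := if k \in K then (\prod_(i < n) h m k x i)%:E else 0%E.
have g_ge0 m k x : (0 <= g m k x)%E.
  by rewrite /g; case: ifP => // _; rewrite lee_fin prodr_ge0.
suff main m : (m <= n)%N -> forall x, (forall i, 0 <= x 0 i <= 1) ->
    (1 <= \sum_(k <oo) g m k x)%E.
  have /= := main n (leqnn n) 0 => /(_ _)/le_trans; apply.
    by move=> i; rewrite mxE lexx ler01.
  rewrite esum_mkcond -nneseries_esumT; last first.
    by move=> k; case: ifP => // _; exact: box_vol_ge0.
  apply: lee_nneseries => // k _; rewrite /g; case: ifP => // _.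
  by rewrite lee_fin /box_vol le_eqVlt; apply/orP; left; apply/eqP;
    apply: eq_bigr => i _; rewrite /h ltn_ord.
elim: m => [_ x x01|m IH mn x x01].
  have [k Kk xk] := cov x x01.
  rewrite (@nneseriesD1 _ _ k xpredT)//= (_ : g 0%N k x = 1%E).
    by rewrite leeDl// nneseries_ge0.
  rewrite /g mem_set// big1// => i _; rewrite /h ltn0.
  by rewrite indicE mem_set//= in_itv/=; exact: xk.
pose i0 := Ordinal mn.
pose c k : R := \prod_(i < n | i != i0) h m k x i.
pose I k : set R := `[(p k).1 0 i0, (p k).2 0 i0]%classic.
have gE k u : g m k (set_coord x i0 u) =
    ((if k \in K then c k else 0%R)%:E * (\1_(I k) u)%:E)%E.
  rewrite /g; case: ifP => _; last by rewrite mul0e.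
  rewrite -EFinM (bigD1 i0)//= mulrC; congr (_ * _)%:E.
    apply: eq_bigr => i ii0; rewrite /h; case: ifP => // _.
    by rewrite set_coord_other.
  by rewrite /h /= ltnn set_coord_same.
have c_ge0 k : 0 <= (if k \in K then c k else 0).
  by case: ifP => // _; rewrite prodr_ge0.
have mI k : measurable (I k) by exact: measurable_itv.
have m1 k : measurable_fun (`[0, 1]%classic : set R)
    (fun u : R => (\1_(I k) u)%:E).
  apply/measurable_EFinP; apply: measurable_funTS; exact: measurable_indic.
have mg k : measurable_fun (`[0, 1]%classic : set R)
    (fun u : R => g m k (set_coord x i0 u)).
  rewrite (funext (gE k)).
  by apply: measurable_funeM; exact: m1.
have -> : 1%E = (\int[@lebesgue_measure R]_(u in `[0%R, 1%R]%classic) 1)%E.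
  by rewrite integral_cst//= lebesgue_measure_itv/= lte_fin ltr01 sube0 mul1e.
apply: (@le_trans _ _ (\int[@lebesgue_measure R]_(u in `[0%R, 1%R]%classic)
    \sum_(k <oo) g m k (set_coord x i0 u))%E).
  apply: ge0_le_integral => //=.
  - apply: (@ge0_emeasurable_sum _ _ _ _ (fun k u => g m k (set_coord x i0 u)) xpredT);
      [by []|by move=> k _; exact: mg].
  - move=> u; rewrite in_itv/= => u01; apply: IH; first exact: ltnW.
    move=> i; have [->|ii0] := eqVneq i i0; first by rewrite set_coord_same.
    by rewrite set_coord_other.
rewrite integral_nneseries//.
apply: lee_nneseries => k; first by move=> _ _; exact: integral_ge0.
move=> _.
have -> : (\int[@lebesgue_measure R]_(u in `[0%R, 1%R]%classic)
    g m k (set_coord x i0 u) = \int[@lebesgue_measure R]_(u in `[0%R, 1%R]%classic)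
      ((if k \in K then c k else 0%R)%:E * (\1_(I k) u)%:E))%E.
  by apply: eq_integral => u _; exact: gE.
rewrite ge0_integralZl//=; [|exact: m1|by rewrite lee_fin].
rewrite integral_indic//=; last exact: mI.
apply: (@le_trans _ _ ((if k \in K then c k else 0%R)%:E * lebesgue_measure (I k))%E).
  rewrite lee_wpmul2l ?lee_fin// le_measure ?inE//.
  - by apply: measurableI; [exact: mI|exact: measurable_itv].
  - exact: mI.
rewrite /I lebesgue_measure_itv/= /g; case: ifP => _; last by rewrite mul0e.
rewrite (bigD1 i0)//= mulrC EFinM; rewrite (_ : \prod_(i < n | _) _ = c k).
  apply: lee_wpmul2l; first by rewrite lee_fin prodr_ge0.
  rewrite /h ltnSn; case: ifP => _; rewrite ?lee_fin le_max ?lexx ?orbT//.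
apply: eq_bigr => i ii0; rewrite /h ltnS leq_eqVlt.
by rewrite -[_ == m]/(i == i0) (negbTE ii0).
Qed.

Definition unit_vol : R := fine (lebesgue R n (cube 0 1)).

Lemma unit_volE : (lebesgue R n (cube 0 1) = unit_vol%:E)%E.
Proof.
rewrite fineK// ge0_fin_numE; last exact: measure_ge0.
rewrite cube_box//; apply: le_lt_trans (lebesgue_outer_box_le _) _.
by rewrite ltry.
Qed.

Lemma unit_vol_gt0 : 0 < unit_vol.
Proof.
rewrite lt_neqAle eq_sym fine_ge0 ?measure_ge0// andbT.
apply/negP => /eqP vol0.
have /ereal_inf_lt[_ [KF cKF <-]] : (lebesgue R n (cube 0 1) < 1)%E.
  by rewrite unit_volE vol0.
apply/negP; rewrite -leNgt; apply: unit_box_cover_vol => x x01.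
apply: cKF; rewrite /cube/= subr0; apply/mx_norm_leP => // i.
by have := x01 i; rewrite ler_norml; lra.
Qed.

Lemma lebesgue_cube x a : 0 < a ->
  (lebesgue R n (cube x a) = (a ^+ n * unit_vol)%:E)%E.
Proof.
move=> a0; have := lebesgue_outer_preimage x (cube x a) a0.
rewrite (_ : _ @^-1` _ = cube 0 1); last first.
  apply/funext => z; rewrite /preimage /cube /mkset addrK subr0 normrZ gtr0_norm//.
  by congr is_true; rewrite -[X in (_ <= X) = _]mulr1 ler_pM2l.
have := unit_volE; rewrite /lebesgue/= => ->.
have an0 : 0 < a^-1 ^+ n by rewrite exprn_gt0 ?invr_gt0.
move=> uE; rewrite EFinM uE muleA -EFinM exprVn divff ?mul1e//.
by rewrite expf_neq0// gt_eqF.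
Qed.

Lemma closed_cube x a : closed (cube x a).
Proof.
have -> : cube x a = closed_ball_ Num.norm x a.
  by apply/funext => z; rewrite /closed_ball_ /cube /mkset distrC.
exact: closed_closed_ball_.
Qed.

Lemma measurable_cube x a : measurable (cube x a : set (lebesgueRn R n)).
Proof.
by apply: borel_lebesgue_measurable; apply: closed_measurable_borelRn;
  exact: closed_cube.
Qed.

Lemma lebesgue_sigma_finite : sigma_finite setT (lebesgue R n).
Proof.
exists (fun k : nat => cube 0 k.+1%:R) => [|k]; last first.
  by split; [exact: measurable_cube|rewrite lebesgue_cube ?ltry].
apply/seteqP; split => // z _; exists (Num.trunc `|z|) => //.
by rewrite /cube/= subr0 ltW// truncnS_gt.
Qed.

End Volume.

(** The Lebesgue measure under a name of its own, on which the sigma-finite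
    structure that Tonelli's theorem asks for can be declared. *)
Definition lebesgue_sf (R : realType) (n : nat) :
    set (lebesgueRn R n) -> \bar R := lebesgue R n.

HB.instance Definition _ (R : realType) (n : nat) :=
  Measure.copy (@lebesgue_sf R n) (lebesgue R n).

HB.instance Definition _ (R : realType) (n : nat) :=
  Measure_isSigmaFinite.Build _ _ _ (@lebesgue_sf R n)
    (@lebesgue_sigma_finite R n).

(** * Nondecreasing functions and dyadic integration *)

Section Hoelder_point.
Context (R : realType).

(** At some point of the middle third of the interval, H is Hoelder continuous
    of exponent 1/2 along a geometric sequence of radii. Cut the middle third
    of an interval into three equal parts: the increments of H on them add up
    to at most the increment on the whole interval, so one part carries at most
    a third of it, while being nine times shorter. Iterate inside that part;
    staying in the middle third keeps a margin on both sides of the limit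
    point. *)
Lemma exists_holder_point (H : R -> R) (c h : R) : 0 < h ->
  {homo H : u v / u <= v} ->
  exists2 s, c + h <= s <= c + 2 * h &
    forall j, H (s + h * 9^-1 ^+ j) - H (s - h * 9^-1 ^+ j) <=
      3^-1 ^+ j * (H (c + 3 * h) - H c).
Proof.
move=> h0 ndH; pose hj j : R := h * 9^-1 ^+ j.
have hjS j : hj j = 9 * hj j.+1 by rewrite /hj exprS; field.
have hj0 j : 0 < hj j by rewrite mulr_gt0// exprn_gt0// invr_gt0.
have step j l : exists l', [/\ l + hj j <= l', l' + 3 * hj j.+1 <= l + 2 * hj j &
    H (l' + 3 * hj j.+1) - H l' <= 3^-1 * (H (l + 3 * hj j) - H l)].
  have := hjS j; have := hj0 j.+1; set g := hj j.+1; move=> g0 ->.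
  have H1 : H l <= H (l + 9 * g) by apply: ndH; lra.
  have H2 : H (l + 18 * g) <= H (l + 3 * (9 * g)) by apply: ndH; lra.
  pose d u := H (u + 3 * g) - H u.
  have e1 : d (l + 9 * g) = H (l + 12 * g) - H (l + 9 * g).
    by rewrite /d; congr (H _ - _); ring.
  have e2 : d (l + 12 * g) = H (l + 15 * g) - H (l + 12 * g).
    by rewrite /d; congr (H _ - _); ring.
  have e3 : d (l + 15 * g) = H (l + 18 * g) - H (l + 15 * g).
    by rewrite /d; congr (H _ - _); ring.
  set D := H (l + 3 * (9 * g)) - H l.
  have [d1|d1] := lerP (d (l + 9 * g)) (3^-1 * D).
    by exists (l + 9 * g); split => //; lra.
  have [d2|d2] := lerP (d (l + 12 * g)) (3^-1 * D).
    by exists (l + 12 * g); split => //; lra.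
  have [d3|d3] := lerP (d (l + 15 * g)) (3^-1 * D).
    by exists (l + 15 * g); split => //; lra.
  by exfalso; rewrite /D in d1 d2 d3; lra.
pose nx j l := projT1 (cid (step j l)).
have nxP j l := projT2 (cid (step j l)).
pose L := fix L j := if j is j'.+1 then nx j' (L j') else c.
have L1 j : L j + hj j <= L j.+1 by have [] := nxP j (L j).
have L2 j : L j.+1 + 3 * hj j.+1 <= L j + 2 * hj j by have [] := nxP j (L j).
have L3 j : H (L j + 3 * hj j) - H (L j) <= 3^-1 ^+ j * (H (c + 3 * h) - H c).
  elim: j => [|j IH]; first by rewrite /hj !expr0 mulr1 mul1r.
  have [_ _ /le_trans] := nxP j (L j); apply.
  by rewrite exprS -mulrA ler_pM2l.
have Llo j k : L j <= L (j + k)%N.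
  elim: k => [|k IH]; first by rewrite addn0.
  by rewrite addnS (le_trans IH)// (le_trans _ (L1 _))// lerDl ltW.
have Lhi j k : L (j + k)%N + 3 * hj (j + k)%N <= L j + 3 * hj j.
  elim: k => [|k IH]; first by rewrite addn0.
  rewrite addnS (le_trans (L2 _))// (le_trans _ IH)// lerD2l ler_pM2r//; lra.
have ubL j : ubound (range L) (L j + 2 * hj j).
  move=> _ [k _ <-]; have [kj|jk] := leqP k j.
    rewrite (le_trans (Llo k (j - k)%N))// subnKC// lerDl mulr_ge0// ltW//.
  have := Lhi j.+1 (k - j.+1)%N; rewrite subnKC//.
  have := L2 j; have := hj0 k; lra.
have supL : has_sup (range L).
  by split; [exists (L 0%N); exists 0%N|exists (L 0%N + 2 * hj 0%N)].
pose s := sup (range L).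
have s1 j : L j + hj j <= s.
  by rewrite (le_trans (L1 j))//; apply: sup_upper_bound => //; exists j.+1.
have s2 j : s <= L j + 2 * hj j by apply: ge_sup => //; exists (L 0%N); exists 0%N.
have hj00 : hj 0%N = h by rewrite /hj expr0 mulr1.
exists s.
  by have := s1 0%N; have := s2 0%N; rewrite hj00 /= => -> ->.
move=> j; apply: le_trans (L3 j).
have := s1 j; have := s2 j; rewrite -/(hj j) => sj1 sj2.
by apply: lerB; apply: ndH; lra.
Qed.

Lemma sum_geometric_le (q : R) N : 0 <= q < 1 ->
  \sum_(0 <= j < N) q ^+ j <= (1 - q)^-1.
Proof.
move=> /andP[q0 q1]; rewrite -[leRHS]mul1r ler_pdivlMr ?subr_gt0//.
suff -> : (\sum_(0 <= j < N) q ^+ j) * (1 - q) = 1 - q ^+ N.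
  by rewrite lerBlDr lerDl exprn_ge0.
elim: N => [|N IH]; first by rewrite big_geq// mul0r expr0 subrr.
by rewrite big_nat_recr//= mulrDl IH exprS; ring.
Qed.

(** Bernoulli's inequality. This ratio is the rate of the geometric weights used
    below: close enough to 1 for its power n - 1 not to spoil a decay of
    ratio 1/3, and at distance 1/(3n) from 1, so that the weights are summable. *)
Lemma bernoulli_ratio (n : nat) : (0 < n)%N ->
  2 / 3 <= (1 - (3 * n%:R)^-1 : R) ^+ n.-1.
Proof.
move=> n0.
have n1 : 0 < n%:R :> R by rewrite ltr0n.
set x := (3 * n%:R)^-1.
have x0 : 0 < x by rewrite invr_gt0 mulr_gt0.
have xn : 3 * (n%:R * x) = 1 by rewrite /x; field; rewrite gt_eqF.
have nx : x <= n%:R * x by rewrite ler_peMl ?(ltW x0)// ler1n.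
have : 1 - n.-1%:R * x <= (1 - x) ^+ n.-1.
  elim: n.-1 => [|m IH]; first by rewrite mul0r subr0 expr0.
  rewrite exprS; apply: (@le_trans _ _ ((1 - x) * (1 - m%:R * x))).
    have : 0 <= m%:R * (x * x) by rewrite !mulr_ge0// ltW.
    rewrite -natr1; nra.
  by rewrite ler_pM2l//; lra.
apply: le_trans.
have : n.-1%:R * x <= n%:R * x by rewrite ler_pM2r// ler_nat leq_pred.
lra.
Qed.

Local Open Scope ereal_scope.

(** G t behaves like an average of a function over a set of size t, tau being a
    free threshold. On the layer (9^-(j+1), 9^-j] take tau = eta (9 th)^j with
    th = 1 - 1/(3n): the first term then contributes eta W th^j, and the
    second one a multiple of (th^-(n-1) / 3)^j, at most 2^-j. Without the factor
    3^-j in the hypothesis no choice of thresholds would make both series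
    converge. *)
Lemma dyadic_integral_bound (G : R -> \bar R) (n : nat) (W M eta : R) :
  (0 < n)%N -> (0 < W)%R -> (0 <= M)%R -> (0 < eta)%R ->
  measurable_fun [set: R] G -> (forall t, 0 <= G t) ->
  (forall (j : nat) (t tau : R), (9^-1 ^+ j.+1 < t <= 9^-1 ^+ j)%R -> (0 < tau)%R ->
    G t <= (tau * W + tau^-1 ^+ n.-1 * (9 ^+ j.+1) ^+ n * 3^-1 ^+ j * M)%:E) ->
  \int[@lebesgue_measure R]_(t in `]0%R, 1%R]%classic) G t <=
    (eta * (3 * n%:R) * W + eta^-1 ^+ n.-1 * 9 ^+ n * 2 * M)%:E.
Proof.
move=> n0 W0 M0 eta0 mG G0 Gle.
have n1 : (0 < n%:R :> R)%R by rewrite ltr0n.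
pose th : R := (1 - (3 * n%:R)^-1)%R.
have th3 : (2 / 3 <= th)%R.
  rewrite /th; have : ((3 * n%:R)^-1 <= 3^-1 :> R)%R.
    rewrite lef_pV2 ?posrE ?mulr_gt0//.
    by have : (1 <= n%:R :> R)%R; [rewrite ler1n|lra].
  lra.
have th0 : (0 < th)%R by lra.
have th1 : (th < 1)%R by rewrite /th ltrBlDr ltrDl invr_gt0 mulr_gt0.
pose q : R := (th^-1 ^+ n.-1 / 3)%R.
have q0 : (0 <= q)%R by rewrite divr_ge0// exprn_ge0// invr_ge0 ltW.
have q2 : (q <= 2^-1)%R.
  have := bernoulli_ratio n0; rewrite -/th => b.
  rewrite /q exprVn ler_pdivrMr// -[leLHS]mul1r ler_pdivrMr ?exprn_gt0//; lra.
pose F (j : nat) : set R := `](9^-1 ^+ j.+1)%R, (9^-1 ^+ j)%R]%classic.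
have p9 j : (0 < 9^-1 ^+ j :> R)%R by rewrite exprn_gt0// invr_gt0.
have F01 : `]0%R, 1%R]%classic = \bigcup_j F j.
  apply/seteqP; split => t /=; rewrite in_itv/=.
    move=> /andP[t0 t1].
    have ex : exists j, (9^-1 ^+ j.+1 < t)%R.
      have [k _ /(_ k (leqnn k))] : \forall k \near \oo, (9^-1 ^+ k < t :> R)%R.
        have /cvgr_lt : ((9^-1 : R) ^+ k)%R @[k --> \oo] --> (0 : R)%R.
          by apply: cvg_expr; rewrite ger0_norm ?invr_ge0// invf_lt1//; lra.
        exact.
      move=> kt; exists k; rewrite (le_lt_trans _ kt)// exprS.
      by rewrite ler_piMl ?ltW// invf_lt1//; lra.
    case: (ex_minnP ex) => j jt jmin; exists j => //; rewrite /F/= in_itv/= jt/=.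
    case: j jt jmin => [|j] jt jmin; first by rewrite expr0.
    by rewrite leNgt; apply/negP => /jmin; rewrite ltnn.
  move=> [j _]; rewrite /F/= in_itv/= => /andP[t1 t2]; rewrite (lt_trans _ t1)//=.
  by rewrite (le_trans t2)// exprn_ile1// ?invr_ge0// invf_le1//; lra.
have tF : trivIset setT F.
  have lt_F i j t : (i < j)%N -> F i t -> F j t -> False.
    move=> ij; rewrite /F/= !in_itv/= => /andP[t1 _] /andP[_ t2].
    have : (9^-1 ^+ j <= 9^-1 ^+ i.+1 :> R)%R.
      by apply: ler_wiXn2l => //; rewrite ?invr_ge0// invf_le1//; lra.
    by move: t1 t2; lra.
  move=> i j _ _ [t [Fi Fj]]; case: (ltngtP i j) => // ij.
    by case: (lt_F _ _ _ ij Fi Fj).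
  by case: (lt_F _ _ _ ij Fj Fi).
rewrite F01 ge0_integral_bigcup//; last 2 first.
- by move=> k; exact: measurable_itv.
- by move: mG; exact: measurable_funS.
pose A : R := (eta * W)%R; pose B : R := (eta^-1 ^+ n.-1 * 9 ^+ n * M)%R.
have A0 : (0 <= A)%R by rewrite mulr_ge0// ltW.
have B0 : (0 <= B)%R by rewrite !mulr_ge0// exprn_ge0// invr_ge0 ltW.
have Fle j : \int[@lebesgue_measure R]_(t in F j) G t <=
    (A * th ^+ j + B * q ^+ j)%:E.
  pose tau : R := (eta * 9 ^+ j * th ^+ j)%R.
  have tau0 : (0 < tau)%R by rewrite !mulr_gt0// exprn_gt0.
  pose c : R := (tau * W + tau^-1 ^+ n.-1 * (9 ^+ j.+1) ^+ n * 3^-1 ^+ j * M)%R.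
  have c0 : (0 <= c)%R.
    apply: addr_ge0; first by rewrite mulr_ge0// ltW.
    by rewrite !mulr_ge0// ?exprn_ge0// ?invr_ge0// ltW.
  apply: (@le_trans _ _ (\int[@lebesgue_measure R]_(t in F j) c%:E)).
    apply: ge0_le_integral => //.
    - exact: measurable_itv.
    - by move: mG; exact: measurable_funS.
    - by move=> t; rewrite /F/= in_itv/= => tj; exact: Gle.
  rewrite integral_cst//; last exact: measurable_itv.
  have mFj : @lebesgue_measure R (F j) <= (9^-1 ^+ j)%:E.
    rewrite /F lebesgue_measure_itv/=; case: ifP => _; last by rewrite lee_fin ltW.
    by rewrite lee_fin gerBl ltW.
  apply: (@le_trans _ _ (c%:E * (9^-1 ^+ j)%:E)).
    by apply: lee_wpmul2l; [rewrite lee_fin|exact: mFj].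
  rewrite -EFinM lee_fin le_eqVlt; apply/orP; left; apply/eqP.
  rewrite /c /tau /A /B /q.
  rewrite mulrDl; congr (_ + _)%R.
    by rewrite exprVn; field; rewrite expf_neq0.
  have -> : (9 ^+ j.+1 = 9 * 9 ^+ j :> R)%R by rewrite exprS.
  have -> : ((th^-1 ^+ n.-1 / 3) ^+ j = ((th ^+ j)^-1) ^+ n.-1 * 3^-1 ^+ j)%R.
    by rewrite exprMn -exprVn exprAC.
  have ninP : n = n.-1.+1 by rewrite prednK.
  move: n.-1 ninP => m ->.
  move: (th ^+ j)%R (expf_neq0 j (lt0r_neq0 th0)) (3^-1 ^+ j)%R => b b0 u.
  have := expf_neq0 j (lt0r_neq0 (ltr0n R 9)).
  rewrite [(9^-1 ^+ j)%R]exprVn; move: (9 ^+ j)%R => a a0.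
  rewrite !invfM !exprMn !exprVn !exprS; field.
  by rewrite ?expf_neq0 ?a0 ?b0 ?gt_eqF.
have sumAB : \sum_(j <oo) (A * th ^+ j + B * q ^+ j)%:E <=
    (A * (1 - th)^-1 + B * 2)%:E.
  have AB0 j : 0 <= (A * th ^+ j + B * q ^+ j)%:E.
    by rewrite lee_fin addr_ge0// mulr_ge0// exprn_ge0// ltW.
  apply: lime_le; first exact: is_cvg_nneseries.
  apply: nearW => N; rewrite sumEFin lee_fin big_split/= -!mulr_sumr.
  apply: lerD; apply: ler_wpM2l => //.
    by apply: sum_geometric_le; rewrite th1 ltW.
  apply: le_trans (sum_geometric_le _ _) _; first by rewrite q0; lra.
  by rewrite -[leRHS]invrK lef_pV2 ?posrE//; lra.
apply: (@le_trans _ _ (\sum_(j <oo) (A * th ^+ j + B * q ^+ j)%:E)).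
  by apply: lee_nneseries => j; [move=> _ _; exact: integral_ge0|move=> _; exact: Fle].
apply: le_trans sumAB _; rewrite lee_fin /A /B /th.
have -> : ((1 - (1 - (3 * n%:R)^-1))^-1 = 3 * n%:R :> R)%R.
  by rewrite opprB addrC subrK invrK.
lra.
Qed.
End Hoelder_point.

(** * Averages over cones of segments *)

Section Tonelli.
Local Open Scope ereal_scope.
Context d1 d2 (T1 : measurableType d1) (T2 : measurableType d2) (R : realType).
Variables (m1 : {sigma_finite_measure set T1 -> \bar R})
          (m2 : {sigma_finite_measure set T2 -> \bar R}).
Variables (A : set T1) (B : set T2) (mA : measurable A) (mB : measurable B).
Variables (f : T1 * T2 -> \bar R) (mf : measurable_fun setT f).
Hypothesis f0 : forall p, 0 <= f p.

Let g := f \_ (setT `*` B).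

Let mg : measurable_fun setT g.
Proof.
apply: (measurable_restrictT f (measurableX measurableT mB)).1.
exact: measurable_funTS.
Qed.

Let g0 p : 0 <= g p.
Proof. by rewrite /g /patch; case: ifP. Qed.

Let gE t : (fun z => g (t, z)) = (fun z => f (t, z)) \_ B.
Proof. by apply/funext => z; rewrite /g /patch in_setX in_setT. Qed.

Lemma measurable_fun_integral_slice :
  measurable_fun setT (fun t => \int[m2]_(z in B) f (t, z)).
Proof.
have := measurable_fun_fubini_tonelli_F (m2 := m2) g mg g0.
rewrite /fubini_F; congr measurable_fun; apply/funext => t.
by rewrite gE -integral_mkcond.
Qed.

Let h := f \_ (A `*` B).

Let mh : measurable_fun setT h.
Proof.
apply: (measurable_restrictT f (measurableX mA mB)).1.
exact: measurable_funTS.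
Qed.

Let h0 p : 0 <= h p.
Proof. by rewrite /h /patch; case: ifP. Qed.

Lemma tonelli_rectangle :
  \int[m2]_(z in B) \int[m1]_(t in A) f (t, z) =
  \int[m1]_(t in A) \int[m2]_(z in B) f (t, z).
Proof.
rewrite [LHS]integral_mkcond [RHS]integral_mkcond.
transitivity (\int[m2]_z \int[m1]_t h (t, z)).
  apply: eq_integral => z _; rewrite [LHS]/patch; case: ifPn => zB.
    rewrite integral_mkcond; apply: eq_integral => t _.
    by rewrite /h /patch in_setX zB andbT.
  rewrite integral0_eq// => t _.
  by rewrite /h /patch in_setX (negbTE zB) andbF.
rewrite -(fubini_tonelli h mh h0); apply: eq_integral => t _.
rewrite [RHS]/patch; case: ifPn => tA.
  rewrite [RHS]integral_mkcond; apply: eq_integral => z _.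
  by rewrite /h /patch in_setX tA.
rewrite integral0_eq// => z _.
by rewrite /h /patch in_setX (negbTE tA).
Qed.

End Tonelli.

Section Cone.
Context (R : realType) (n : nat).
Local Notation V := 'rV[R]_n.

(** A linear substitute for Hoelder's inequality: either r is below the
    threshold tau, or r <= r (r / tau)^(n-1). The threshold can be adapted to
    each scale. *)
Lemma le_add_scaled_expe (r : \bar R) (tau : R) : (0 < n)%N -> 0 < tau ->
  (0 <= r -> r <= tau%:E + (tau^-1 ^+ n.-1)%:E * r ^+ n)%E.
Proof.
move=> n0 tau0; have t0 : 0 < tau^-1 ^+ n.-1 by rewrite exprn_gt0 ?invr_gt0.
case: r => [r| |]//.
  rewrite lee_fin => r0; rewrite -EFin_expe -EFinM -EFinD lee_fin.
  have [rt|tr] := leP r tau.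
    by rewrite (le_trans rt)// lerDl mulr_ge0 ?(ltW t0) ?exprn_ge0.
  rewrite -[in r ^+ n](prednK n0) exprS mulrCA -exprMn.
  have : 1 <= (tau^-1 * r) ^+ n.-1.
    by rewrite exprn_ege1// mulrC ler_pdivlMr// mul1r ltW.
  by move: tau0; nra.
move=> _; have -> : (+oo ^+ n = +oo :> \bar R)%E.
  rewrite -(prednK n0); elim: n.-1 => // m IH.
  by rewrite expeS IH mulyy.
by rewrite gt0_muley ?lte_fin// addey.
Qed.

Lemma measurable_expe d (T : measurableType d) (f : T -> \bar R) m :
  measurable_fun setT f -> measurable_fun setT (fun x => f x ^+ m)%E.
Proof.
move=> mf; elim: m => [|m IH]; first exact: measurable_cst.
by under eq_fun do rewrite expeS; exact: emeasurable_funM.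
Qed.

Lemma integral_le_add_scaled_expe d (T : measurableType d)
    (mu : {measure set T -> \bar R}) (D : set T) (s : T -> \bar R) (tau : R) :
  measurable D -> measurable_fun setT s -> (forall z, 0 <= s z)%E ->
  (0 < n)%N -> 0 < tau ->
  (\int[mu]_(z in D) s z <= tau%:E * mu D +
    (tau^-1 ^+ n.-1)%:E * \int[mu]_(z in D) s z ^+ n)%E.
Proof.
move=> mD ms s0 n0 tau0; pose c := tau^-1 ^+ n.-1.
have c0 : 0 <= c by rewrite exprn_ge0// invr_ge0 ltW.
have sn0 z : (0 <= s z ^+ n)%E by exact: expe_ge0.
have msn : measurable_fun D (fun z => s z ^+ n)%E.
  by apply: measurable_funTS; exact: measurable_expe.
apply: (@le_trans _ _ (\int[mu]_(z in D) (tau%:E + c%:E * s z ^+ n))%E).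
  apply: ge0_le_integral => //.
  - exact: measurable_funTS.
  - by apply: emeasurable_funD => //; exact: measurable_funeM.
  - by move=> z _; exact: le_add_scaled_expe.
rewrite ge0_integralD//.
- by rewrite integral_cst// ge0_integralZl// lee_fin.
- by move=> z _; rewrite lee_fin ltW.
- by move=> z _; rewrite mule_ge0 ?lee_fin.
- exact: measurable_funeM.
Qed.

Lemma measurable_segment_coord d (T : measurableType d) (f g : T -> R) (c : R) :
  measurable_fun setT f -> measurable_fun setT g ->
  measurable_fun setT (fun p => c + f p * (g p - c)).
Proof.
move=> mf mg; apply: measurable_funD => //; apply: measurable_funM => //.
exact: measurable_funB.
Qed.

Lemma measurable_cone (x : V) (rho : V -> \bar R) :
  measurable_fun [set: borelRn R n] (rho : borelRn R n -> \bar R) ->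
  measurable_fun [set: (measurableTypeR R * lebesgueRn R n)%type]
    (fun tz => rho (x + (tz.1 : R) *: ((tz.2 : V) - x))).
Proof.
move=> mrho; apply: (measurableT_comp mrho).
apply: (@measurable_rV R n _ (measurableTypeR R * lebesgueRn R n)%type
  (fun tz => x + (tz.1 : R) *: ((tz.2 : V) - x))) => i.
rewrite (_ : (fun _ => _) = fun tz : (measurableTypeR R * lebesgueRn R n)%type =>
  x 0 i + (tz.1 : R) * ((tz.2 : V) 0 i - x 0 i)); last first.
  by apply/funext => tz; rewrite !mxE.
apply: measurable_segment_coord; first exact: measurable_fst.
exact: (measurableT_comp (measurable_coord i) measurable_snd).
Qed.

Local Open Scope ereal_scope.

(** For a fixed t the point x + t (z - x) runs over a homothetic copy of the
    cube of ratio t, so averaging over the apex z replaces the integral of rho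
    along a segment by integrals over cubes that shrink towards x. In terms of
    the n-th power of rho this is exactly the borderline case: a mere bound M
    on the mass would give a logarithmically divergent integral, and
    the decay 3^-j is what saves the estimate. *)
Lemma cone_integral_bound (x w : V) (rho : V -> \bar R) (r M eta : R) :
  (0 < n)%N -> (0 < r)%R -> (0 <= M)%R -> (0 < eta)%R ->
  measurable_fun [set: borelRn R n] (rho : borelRn R n -> \bar R) ->
  (forall z, 0 <= rho z) ->
  (forall j t, (9^-1 ^+ j.+1 < t <= 9^-1 ^+ j)%R ->
    \int[lebesgue R n]_(z in cube w r) rho (x + t *: (z - x))%R ^+ n <=
      (t^-1 ^+ n * 3^-1 ^+ j * M)%:E) ->
  \int[lebesgue R n]_(z in cube w r)
    \int[lebesgue_measure]_(t in `]0%R, 1%R]%classic) rho (x + t *: (z - x))%R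
  <= (eta * (3 * n%:R) * (r ^+ n * unit_vol R n)
      + eta^-1 ^+ n.-1 * 9 ^+ n * 2 * M)%:E.
Proof.
move=> n0 r0 M0 eta0 mrho rho0 mass.
have mcube := measurable_cube w r.
have mc := measurable_cone x mrho.
have W0 : (0 < r ^+ n * unit_vol R n)%R by rewrite mulr_gt0 ?exprn_gt0// unit_vol_gt0.
rewrite (tonelli_rectangle (@lebesgue_measure R) (@lebesgue_sf R n)
  (measurable_itv _) mcube mc)//.
apply: dyadic_integral_bound => //.
- exact: (measurable_fun_integral_slice (@lebesgue_sf R n) mcube mc).
- by move=> t; exact: integral_ge0.
move=> j t tau tj tau0.
have t0 : (0 < t)%R.
  by case/andP: tj => + _; apply: lt_trans; rewrite exprn_gt0// invr_gt0.
have ms : measurable_fun [set: lebesgueRn R n]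
    (fun z : lebesgueRn R n => rho (x + t *: ((z : V) - x))%R).
  exact: (measurable_fun_pair2 (t : measurableTypeR R) mc).
pose s (z : lebesgueRn R n) := rho (x + t *: ((z : V) - x))%R.
pose c := (tau^-1 ^+ n.-1)%R.
have c0 : (0 <= c)%R by rewrite exprn_ge0// invr_ge0 ltW.
have s0 z : 0 <= s z by exact: rho0.
apply: le_trans (integral_le_add_scaled_expe (lebesgue R n) mcube ms s0 n0 tau0) _.
rewrite EFinD; apply: leeD.
  have := @lebesgue_cube R n w r r0.
  by move=> e; rewrite EFinM e.
apply: (@le_trans _ _ (c%:E * (t^-1 ^+ n * 3^-1 ^+ j * M)%:E)).
  by apply: lee_wpmul2l; [rewrite lee_fin|exact: mass].
rewrite -EFinM lee_fin -/c -!mulrA ler_wpM2l// !mulrA.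
rewrite ler_wpM2r// ler_wpM2r ?exprn_ge0//.
apply: lerXn2r; rewrite ?nnegrE ?invr_ge0 ?exprn_ge0 ?(ltW t0)//.
have [/ltW tj1 _] := andP tj.
by rewrite -[leRHS]invrK lef_pV2 ?posrE ?invr_gt0 ?exprn_gt0// -exprVn.
Qed.

End Cone.

(** * Short segments towards a common apex *)

Section Averaging.
Local Open Scope ereal_scope.

Lemma exists_sum_lt_average d (T : measurableType d) (R : realType)
    (mu : {measure set T -> \bar R}) (D : set T) (f g : T -> \bar R) (c : R) :
  measurable D -> measurable_fun D f -> measurable_fun D g ->
  (forall z, 0 <= f z) -> (forall z, 0 <= g z) -> (0 <= c)%R ->
  \int[mu]_(z in D) f z + \int[mu]_(z in D) g z < c%:E * mu D ->
  exists2 z, D z & f z + g z < c%:E.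
Proof.
move=> mD mf mg f0 g0 c0 fgc; apply: contrapT => /forall2NP nex.
move: fgc; apply/negP; rewrite -leNgt -ge0_integralD// -integral_cst//.
apply: ge0_le_integral => //; first exact: emeasurable_funD.
by move=> z Dz; rewrite leNgt; apply/negP; case: (nex z).
Qed.

Lemma measurable_fun_integral_slice_swap d1 d2 (T1 : measurableType d1)
    (T2 : measurableType d2) (R : realType)
    (m1 : {sigma_finite_measure set T1 -> \bar R}) (A : set T1)
    (f : T1 * T2 -> \bar R) :
  measurable A -> measurable_fun setT f -> (forall p, 0 <= f p) ->
  measurable_fun setT (fun z => \int[m1]_(t in A) f (t, z)).
Proof.
move=> mA mf f0.
apply: (measurable_fun_integral_slice m1 mA (f := fun p : T2 * T1 => f (p.2, p.1))) => //.
exact: (measurableT_comp mf (@measurable_swap _ _ T2 T1)).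
Qed.

End Averaging.

Section Apex.
Context (R : realType) (n : nat).
Local Notation V := 'rV[R]_n.

Definition segment_integral (rho : V -> \bar R) (x z : V) : \bar R :=
  (\int[lebesgue_measure]_(t in `]0%R, 1%R]%classic) rho (x + t *: (z - x))%R)%E.

(** The mass of rho^n on the homothetic copy of ratio t of the cube decays like
    the square root of t, written on the layers 9^-(j+1) < t <= 9^-j; the
    factor t^-n is the Jacobian of the homothety. *)
Definition cone_mass_le (rho : V -> \bar R) (x w : V) (r M : R) : Prop :=
  forall j t, 9^-1 ^+ j.+1 < t <= 9^-1 ^+ j ->
    (\int[lebesgue R n]_(z in cube w r) rho (x + t *: (z - x))%R ^+ n <=
      (t^-1 ^+ n * 3^-1 ^+ j * M)%:E)%E.

(** The two segment integrals are small on average over the cube, hence small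
    for some z in it. The threshold M depends on the dimension only:
    the mass of rho^n is invariant under scaling, and so is the conclusion once
    multiplied by the length scale a. *)
Lemma exists_short_apex : (0 < n)%N -> exists2 M : R, 0 < M &
  forall (a : R) (x y w : V) (rho : V -> \bar R), 0 < a ->
    measurable_fun [set: borelRn R n] (rho : borelRn R n -> \bar R) ->
    (forall z, 0 <= rho z)%E ->
    cone_mass_le rho x w (a / 16) M -> cone_mass_le rho y w (a / 16) M ->
    exists2 z, cube w (a / 16) z &
      (segment_integral rho x z + segment_integral rho y z <
        ((6 * n%:R * a)^-1)%:E)%E.
Proof.
move=> n0; pose N : R := n%:R; have N0 : 0 < N by rewrite ltr0n.
have om0 := unit_vol_gt0 R n; set om := unit_vol R n in om0 *.
pose b : R := (72 * N * N) ^+ n.-1 * 9 ^+ n.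
have b0 : 0 < b by rewrite /b !(mulr_gt0, exprn_gt0).
(* With q = a^(n-1) om / (16^n N), the volume of the cube divided by 6 N a is
   q / 6; this M and the eta below make the two terms of the bound, doubled,
   equal to q / 12 and q / 24. *)
pose M := om / (16 ^+ n * b * N * 96).
have M0 : 0 < M by rewrite /M divr_gt0 ?(mulr_gt0, exprn_gt0).
exists M => // a x y w rho a0 mrho rho0 mx my.
have r0 : 0 < a / 16 by rewrite divr_gt0.
pose eta : R := (72 * N * N * a)^-1.
have eta0 : 0 < eta by rewrite /eta invr_gt0 !mulr_gt0.
have cx := cone_integral_bound n0 r0 (ltW M0) eta0 mrho rho0 mx.
have cy := cone_integral_bound n0 r0 (ltW M0) eta0 mrho rho0 my.
apply: (exists_sum_lt_average (mu := lebesgue R n)) => //.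
- exact: measurable_cube.
- apply: measurable_funTS.
  apply: (measurable_fun_integral_slice_swap (@lebesgue_measure R)
    (measurable_itv _) (measurable_cone x mrho)).
  by move=> p; exact: rho0.
- apply: measurable_funTS.
  apply: (measurable_fun_integral_slice_swap (@lebesgue_measure R)
    (measurable_itv _) (measurable_cone y mrho)).
  by move=> p; exact: rho0.
- by move=> z; apply: integral_ge0 => t _; exact: rho0.
- by move=> z; apply: integral_ge0 => t _; exact: rho0.
- by rewrite invr_ge0 !mulr_ge0// ltW.
apply: (le_lt_trans (leeD cx cy)).
rewrite [X in (_ < _ * X)%E](lebesgue_cube w r0) -EFinD -EFinM lte_fin.
rewrite -/om -/N.
have -> : eta^-1 = 72 * N * N * a by rewrite /eta invrK.
rewrite exprMn -!mulrA.
have an : a ^+ n = a ^+ n.-1 * a by rewrite -exprSr prednK.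
have -> : (72 * (N * (N * a))) ^+ n.-1 * (9 ^+ n * (2 * M)) = 2 * M * b * a ^+ n.-1.
  by rewrite /b !mulrA exprMn; ring.
have -> : 2 * M * b * a ^+ n.-1 = 2 * om * a ^+ n.-1 / (16 ^+ n * N * 96).
  by rewrite /M; field; rewrite ?gt_eqF ?exprn_gt0.
rewrite an /eta exprVn.
have : 0 < a ^+ n.-1 * om / 16 ^+ n / N.
  by rewrite !divr_gt0 ?mulr_gt0 ?exprn_gt0.
set q := (X in 0 < X) => q0.
set lhs := (X in X < _); set rhs := (X in _ < X).
have -> : lhs = q * (8^-1).
  rewrite /lhs /q; field; rewrite ?gt_eqF ?exprn_gt0//.
have -> : rhs = q * (6^-1).
  rewrite /rhs /q; field; rewrite ?gt_eqF ?exprn_gt0//.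
by rewrite ltr_pM2l//; lra.
Qed.

(** The increments over the first N scales telescope to at most K, so they
    cannot all be as large as M. *)
Lemma exists_scale_small_increment (P : R -> R) (K M u : R) (N : nat) :
  (forall v, 0 <= P v <= K) -> K < N%:R * M ->
  exists2 k, (k < N)%N & P (u / 64 ^+ k) - P (u / 64 ^+ k.+1) < M.
Proof.
move=> PK KM; apply: contrapT => /forall2NP nex.
pose f k := - P (u / 64 ^+ k).
have : \sum_(0 <= k < N) M <= \sum_(0 <= k < N) (f k.+1 - f k).
  rewrite !big_nat; apply: ler_sum => k kN; rewrite /f opprK addrC leNgt.
  by apply/negP; case: (nex k).
rewrite telescope_sumr// sumr_const_nat subn0 -mulr_natl /f opprK.
have /andP[_ PK0] := PK (u / 64 ^+ 0); have /andP[P0 _] := PK (u / 64 ^+ N).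
by move: KM; lra.
Qed.

(** A segment between two vectors of norm s comes close to the origin only near
    its midpoint, and only if the two vectors are almost opposite. Moving the
    end point w to a nearby z costs at most a / 16. *)
Lemma segment_avoids_center (x w z : V) (a s t : R) :
  0 < a -> a <= s <= 2 * a -> `|x| = s -> `|w| = s -> s / 2 <= `|x + w| ->
  `|z - w| <= a / 16 -> 0 <= t <= 1 ->
  a / 16 <= `|x + t *: (z - x)| < 4 * a.
Proof.
move=> a0 /andP[sa s2a] xs ws xw zw /andP[t0 t1].
have eqz : x + t *: (z - x) = ((1 - t) *: x + t *: w) + t *: (z - w).
  by rewrite !scalerBr scalerBl scale1r; apply/rowP => i; rewrite !mxE; ring.
have tzw : `|t *: (z - w)| <= a / 16.
  by rewrite normrZ ger0_norm// (le_trans _ zw)// ler_piMl.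
set u := (1 - t) *: x + t *: w in eqz.
have u_le : `|u| <= s.
  rewrite (le_trans (ler_normD _ _))// !normrZ xs ws !ger0_norm ?subr_ge0//.
  by rewrite -mulrDl subrK mul1r.
have u_ge : s / 8 <= `|u|.
  rewrite leNgt; apply/negP => us.
  have h1 : `|1 - 2 * t| * s <= `|u|.
    have : `| `|(1 - t) *: x| - `|- (t *: w)| | <= `|u|.
      by rewrite -[u]/((1 - t) *: x + t *: w) -[t *: w in leRHS]opprK ler_dist_dist.
    rewrite normrN !normrZ xs ws (ger0_norm t0) (@ger0_norm _ (1 - t)) ?subr_ge0//.
    rewrite -mulrBl normrM [X in _ * X]ger0_norm; last by rewrite -xs.
    by have -> : 1 - t - t = 1 - 2 * t by ring.
  have s0 : 0 < s by move: us; have := normr_ge0 u; lra.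
  have h2 : `|x + w| <= 2 * `|u| + `|1 - 2 * t| * (2 * s).
    have -> : x + w = 2 *: u - (1 - 2 * t) *: (x - w).
      by apply/rowP => i; rewrite /u !mxE; ring.
    rewrite (le_trans (ler_normB _ _))// !normrZ ger0_norm// lerD2l ler_wpM2l//.
    by rewrite (le_trans (ler_normB _ _))// xs ws; lra.
  move: h1 h2 us xw; rewrite mulrCA.
  by move: (`|1 - 2 * t| * s) => p; lra.
rewrite eqz; apply/andP; split.
  have := lerB_normD u (t *: (z - w)); lra.
by have := ler_normD u (t *: (z - w)); lra.
Qed.

(** Two vectors w which both fail the requirement for x are at distance less
    than s from each other. The vectors s e0, - s e0 and s e1, which exist
    since the dimension is at least 2, are pairwise at distance at least s, so
    each of x and y excludes at most one of the three. *)
Lemma exists_apex_direction (x y : V) (s : R) : (2 <= n)%N -> 0 < s ->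
  exists w : V, [/\ `|w| = s, s / 2 <= `|x + w| & s / 2 <= `|y + w|].
Proof.
move=> n2 s0.
pose i0 : 'I_n := Ordinal (ltnW n2); pose i1 : 'I_n := Ordinal n2.
pose e i : V := s *: delta_mx 0 i.
have eE i j : e i 0 j = if j == i then s else 0.
  by rewrite !mxE eqxx /=; case: eqP => _; rewrite ?mulr1 ?mulr0.
have en i : `|e i| = s.
  apply/eqP; rewrite eq_le; apply/andP; split.
    apply/mx_norm_leP; first exact: ltW.
    by move=> j; rewrite eE; case: ifP => _; rewrite ?normr0 ?gtr0_norm// ltW.
  by have := coord_le_norm (e i) i; rewrite eE eqxx gtr0_norm.
have far (v c c' : V) i : s <= `|c 0 i - c' 0 i| ->
    `|v + c| < s / 2 -> `|v + c'| < s / 2 -> False.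
  move=> h h1 h2; have := coord_le_norm (c - c') i.
  have := ler_normB (v + c) (v + c').
  by rewrite opprD addrACA subrr add0r !mxE; move: h h1 h2; lra.
have d1 : s <= `|e i0 0 i0 - (- e i0) 0 i0|.
  by rewrite [X in _ - X]mxE opprK eE eqxx gtr0_norm ?addr_gt0// lerDl ltW.
have d2 : s <= `|e i0 0 i0 - e i1 0 i0|.
  by rewrite !eE eqxx /= subr0 gtr0_norm.
have d3 : s <= `|(- e i0) 0 i0 - e i1 0 i0|.
  by rewrite [X in X - _]mxE !eE eqxx /= subr0 normrN gtr0_norm.
have nN : `|- e i0| = s by rewrite normrN.
have [x1|x1] := lerP (s / 2) `|x + e i0|; have [y1|y1] := lerP (s / 2) `|y + e i0|.
- by exists (e i0).
- have [y2|y2] := lerP (s / 2) `|y - e i0|; last by case: (far _ _ _ _ d1 y1 y2).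
  have [y3|y3] := lerP (s / 2) `|y + e i1|; last by case: (far _ _ _ _ d2 y1 y3).
  have [x2|x2] := lerP (s / 2) `|x - e i0|; first by exists (- e i0).
  have [x3|x3] := lerP (s / 2) `|x + e i1|; first by exists (e i1).
  by case: (far _ _ _ _ d3 x2 x3).
- have [x2|x2] := lerP (s / 2) `|x - e i0|; last by case: (far _ _ _ _ d1 x1 x2).
  have [x3|x3] := lerP (s / 2) `|x + e i1|; last by case: (far _ _ _ _ d2 x1 x3).
  have [y2|y2] := lerP (s / 2) `|y - e i0|; first by exists (- e i0).
  have [y3|y3] := lerP (s / 2) `|y + e i1|; first by exists (e i1).
  by case: (far _ _ _ _ d3 y2 y3).
- have [x2|x2] := lerP (s / 2) `|x - e i0|; last by case: (far _ _ _ _ d1 x1 x2).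
  have [y2|y2] := lerP (s / 2) `|y - e i0|; last by case: (far _ _ _ _ d1 y1 y2).
  by exists (- e i0).
Qed.

End Apex.

Section Increment.
Local Open Scope ereal_scope.
Context d (T : measurableType d) (R : realType) (mu : {measure set T -> \bar R}).
Variables (f : T -> \bar R) (N : T -> R) (K : R).
Hypotheses (mf : measurable_fun setT f) (f0 : forall z, 0 <= f z)
  (fK : \int[mu]_z f z <= K%:E)
  (mN : forall u, measurable [set z | N z < u]%R).

(** Recording the mass of f by the distance N to a centre turns statements about
    all points of a sphere into statements about one nondecreasing function. *)
Definition radial_mass (u : R) : R := fine (\int[mu]_(z in [set z | (N z < u)%R]) f z).

Let mass_le u : \int[mu]_(z in [set z | (N z < u)%R]) f z <= K%:E.
Proof. by apply: le_trans fK; apply: ge0_subset_integral. Qed.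

Let massE u : \int[mu]_(z in [set z | (N z < u)%R]) f z = (radial_mass u)%:E.
Proof.
rewrite fineK// ge0_fin_numE; last exact: integral_ge0.
exact: le_lt_trans (mass_le u) (ltry _).
Qed.

Lemma radial_mass_ge0 u : (0 <= radial_mass u)%R.
Proof. by rewrite -lee_fin -massE; exact: integral_ge0. Qed.

Lemma radial_mass_le u : (radial_mass u <= K)%R.
Proof. by rewrite -lee_fin -massE. Qed.

Lemma integral_shell u v : (u <= v)%R ->
  \int[mu]_(z in [set z | (u <= N z < v)%R]) f z =
  (radial_mass v - radial_mass u)%:E.
Proof.
move=> uv.
have E : [set z | (N z < v)%R] =
    [set z | (N z < u)%R] `|` [set z | (u <= N z < v)%R].
  apply/seteqP; split => z /=.
    by move=> zv; have [zu|zu] := ltP (N z) u; [left|right].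
  by case=> [zu|/andP[]//]; exact: lt_le_trans uv.
have mS : measurable [set z | (u <= N z < v)%R].
  rewrite (_ : [set _ | _] = [set z | (N z < v)%R] `\` [set z | (N z < u)%R]).
    exact: measurableD.
  apply/seteqP; split => z /=.
    by move=> /andP[zu zv]; split => //; rewrite ltNge zu.
  by move=> [-> /negP]; rewrite -leNgt => ->.
have := massE v; rewrite E ge0_integral_setU//; last 2 first.
- exact: measurable_funTS.
- rewrite disj_set2E; apply/eqP; rewrite -subset0 => z [/= zu /andP[]].
  by rewrite leNgt zu.
rewrite massE => h; rewrite EFinB -h addeAC subee// add0e//.
Qed.

Lemma radial_mass_homo : {homo radial_mass : u v / (u <= v)%R}.
Proof.
move=> u v uv; rewrite -subr_ge0 -lee_fin -integral_shell//.
exact: integral_ge0.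
Qed.

End Increment.

(** * Short broken lines between two radially large sets *)

Section ShortBrokenLine.
Context (R : realType) (n : nat).
Local Notation V := 'rV[R]_n.

Lemma borel_measurable_dist_lt (y0 : V) (u : R) :
  measurable ([set z | `|z - y0| < u] : set (borelRn R n)).
Proof.
apply: open_measurable_borelRn.
rewrite (_ : [set _ | _] = ball y0 u); first exact: ball_open.
by apply/funext => z; rewrite -ball_normE /ball_/= distrC.
Qed.

Lemma borel_measurable_shell (y0 : V) (u v : R) :
  measurable ([set z | u <= `|z - y0| < v] : set (borelRn R n)).
Proof.
rewrite (_ : [set _ | _] =
  [set z | `|z - y0| < v] `\` [set z | `|z - y0| < u]).
  by apply: measurableD; exact: borel_measurable_dist_lt.
apply/seteqP; split => z /=.
  by move=> /andP[zu zv]; split => //; rewrite ltNge zu.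
by move=> [-> /negP]; rewrite -leNgt => ->.
Qed.

Lemma measurable_density (rho : V -> \bar R) :
  measurable_fun [set: borelRn R n] (rho : borelRn R n -> \bar R) ->
  measurable_fun [set: lebesgueRn R n]
    ((fun z => rho z ^+ n)%E : lebesgueRn R n -> \bar R).
Proof.
move=> mrho; apply: measurable_expe.
exact: (measurableT_comp mrho (@measurable_id_borelRn R n)).
Qed.

Local Notation mass rho y0 :=
  (radial_mass (lebesgue R n) (fun z : V => (rho z ^+ n)%E) (fun z : V => `|z - y0|)).

(** The copy of ratio t of the cube lies within distance 5ta of x, hence in a
    shell around the sphere of radius s, whose mass is controlled by the choice
    of s. For the two largest values of 9^-j that shell may be too thick for
    the hypothesis on s, and the whole annulus is used instead. *)
Lemma cone_mass_le_radial (x w y0 : V) (rho : V -> \bar R) (K a s k M : R) :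
  measurable_fun [set: borelRn R n] (rho : borelRn R n -> \bar R) ->
  (forall z, 0 <= rho z)%E ->
  (\int[lebesgue R n]_z rho z ^+ n <= K%:E)%E ->
  0 < a -> a + a / 3 <= s <= a + 2 * (a / 3) ->
  `|x - y0| = s -> `|w - y0| = s -> s / 2 <= `|(x - y0) + (w - y0)| ->
  (forall j, mass rho y0 (s + a / 3 * 9^-1 ^+ j) -
             mass rho y0 (s - a / 3 * 9^-1 ^+ j) <= 3^-1 ^+ j * k) ->
  mass rho y0 (4 * a) - mass rho y0 (a / 16) <= k -> 9 * k <= M ->
  cone_mass_le rho x w (a / 16) M.
Proof.
move=> mrho rho0 rhoK a0 /andP[s1 s2] xs ws xw Hk kk kM j t /andP[t1 t2].
have p9 i : 0 < 9^-1 ^+ i :> R by rewrite exprn_gt0// invr_gt0.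
have t0 : 0 < t by exact: lt_trans t1.
have t11 : t <= 1.
  by rewrite (le_trans t2)// exprn_ile1// ?invr_ge0// invf_le1//; lra.
have mdens := measurable_density mrho.
have dens0 z : (0 <= rho z ^+ n)%E by exact: expe_ge0.
have mshell u : measurable ([set z | `|z - y0| < u] : set (lebesgueRn R n)).
  by apply: borel_lebesgue_measurable; exact: borel_measurable_dist_lt.
have k0 : 0 <= k.
  apply: le_trans kk; rewrite subr_ge0.
  by apply: (radial_mass_homo mdens dens0 rhoK mshell); lra.
have [u [v [uv uvM shell]]] : exists u v, [/\ u <= v,
    mass rho y0 v - mass rho y0 u <= 3^-1 ^+ j * M &
    forall z, cube w (a / 16) z -> u <= `|x + t *: (z - x) - y0| < v].
  have inA z : cube w (a / 16) z -> a / 16 <= `|x + t *: (z - x) - y0| < 4 * a.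
    move=> zw.
    have -> : x + t *: (z - x) - y0 =
        (x - y0) + t *: ((z - y0) - (x - y0)).
      by apply/rowP => i; rewrite !mxE; ring.
    apply: (@segment_avoids_center _ _ _ (w - y0) _ _ s) => //.
    - by lra.
    - by rewrite opprB addrA subrK.
    - by rewrite ltW.
  have crude i : (i <= 2)%N -> k <= 3^-1 ^+ i * M.
    move=> i2; apply: (@le_trans _ _ (3^-1 ^+ 2 * M)); first by rewrite expr2; lra.
    rewrite ler_wpM2r//; first by lra.
    by rewrite ler_wiXn2l ?invr_ge0// invf_le1//; lra.
  case: j t1 t2 => [|[|j]] t1 t2.
  - by exists (a / 16), (4 * a); split => //; [lra|exact: le_trans kk (crude 0%N _)].
  - by exists (a / 16), (4 * a); split => //; [lra|exact: le_trans kk (crude 1%N _)].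
  exists (s - a / 3 * 9^-1 ^+ j), (s + a / 3 * 9^-1 ^+ j); split.
  - by have := mulr_gt0 a0 (p9 j); lra.
  - apply: le_trans (Hk j) _; rewrite -[X in _ ^+ X * M]addn2 exprD -mulrA.
    by rewrite ler_pM2l ?exprn_gt0// expr2; lra.
  move=> z zw.
  have zx : `|z - x| <= 5 * a.
    have -> : z - x = (z - w) + ((w - y0) - (x - y0)).
      by apply/rowP => i; rewrite !mxE; ring.
    have := ler_normD (z - w) ((w - y0) - (x - y0)).
    have := ler_normB (w - y0) (x - y0); rewrite xs ws.
    by move: zw; rewrite /cube/=; lra.
  have tzx : `|t *: (z - x)| < a / 3 * 9^-1 ^+ j.
    rewrite normrZ gtr0_norm//; apply: (@le_lt_trans _ _ (9^-1 ^+ j.+2 * (5 * a))).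
      by apply: ler_pM => //; exact: ltW.
    by rewrite !exprS; have := mulr_gt0 a0 (p9 j); lra.
  have := lerB_normD (x - y0) (t *: (z - x)).
  have := ler_normD (x - y0) (t *: (z - x)).
  have -> : x - y0 + t *: (z - x) = x + t *: (z - x) - y0.
    by apply/rowP => i; rewrite !mxE; ring.
  by rewrite xs => h1 h2; apply/andP; split; lra.
pose S := [set z | u <= `|z - y0| < v].
have mS : measurable (S : set (borelRn R n)) by exact: borel_measurable_shell.
have tE z : x + t *: (z - x) = t *: z + (x - t *: x).
  by rewrite scalerBr addrC addrAC addrA.
have aff := integral_affine (x - t *: x) t0 mS
  (measurable_expe n mrho) dens0.
apply: (@le_trans _ _ (\int[lebesgue R n]_(z in
    (fun z : V => t *: z + (x - t *: x))%R @^-1` S)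
      rho (t *: z + (x - t *: x))%R ^+ n)%E).
  under eq_integral do rewrite tE.
  apply: ge0_subset_integral.
  - exact: measurable_cube.
  - rewrite -[_ @^-1` _]setTI; exact: (@measurable_affine R n t (x - t *: x)).
  - apply: measurable_funTS; apply: measurable_expe.
    exact: (measurableT_comp mrho (@measurable_affine R n t (x - t *: x))).
  - by move=> z _; exact: dens0.
  - by move=> z zw; rewrite /preimage /S /= -tE; exact: shell.
rewrite [leLHS]aff.
have -> := integral_shell mdens dens0 rhoK mshell uv.
rewrite -EFinM lee_fin -mulrA ler_wpM2l// exprn_ge0// invr_ge0 ltW//.
Qed.

(** Among N annuli of ratio 64 around y0 one carries little mass of rho^n, with
    a bound as small as desired when N is large. Inside it choose a radius s at
    which the radial mass is Hoelder continuous: this makes the mass of the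
    cones issued from any point of that sphere decay, whatever points of X and
    Y lie on it. A common apex for the points of X and Y then gives the broken line. *)
Lemma exists_short_broken_line (K r0 : R) : (2 <= n)%N -> 0 <= K -> 0 < r0 ->
  exists2 d : R, 0 < d & forall (y0 : V) (X Y : set V) (rho : V -> \bar R),
    measurable_fun [set: borelRn R n] (rho : borelRn R n -> \bar R) ->
    (forall z, 0 <= rho z)%E ->
    (\int[lebesgue R n]_z rho z ^+ n <= K%:E)%E ->
    (forall s, d <= s <= r0 -> exists2 x, X x & `|x - y0| = s) ->
    (forall s, d <= s <= r0 -> exists2 y, Y y & `|y - y0| = s) ->
    exists x y z (a : R), [/\ X x, Y y, 0 < a,
      forall t, 0 <= t <= 1 -> `|x + t *: (z - x) - y0| <= r0 /\
                                `|y + t *: (z - y) - y0| <= r0 &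
      [/\ `|z - x| <= 6 * a, `|z - y| <= 6 * a &
      (segment_integral rho x z + segment_integral rho y z <
        ((6 * n%:R * a)^-1)%:E)%E]].
Proof.
move=> n2 K0 r00; have n0 : (0 < n)%N by exact: ltnW.
have [M M0 apex] := @exists_short_apex R n n0.
pose N := (Num.trunc (K / (M / 9))).+1.
have NM : K < N%:R * (M / 9).
  by rewrite -ltr_pdivrMr ?divr_gt0// truncnS_gt.
exists (r0 / 64 ^+ N / 4); first by rewrite !divr_gt0// exprn_gt0.
move=> y0 X Y rho mrho rho0 rhoK hX hY.
have mdens := measurable_density mrho.
have dens0 z : (0 <= rho z ^+ n)%E by exact: expe_ge0.
have mshell u : measurable ([set z | `|z - y0| < u] : set (lebesgueRn R n)).
  by apply: borel_lebesgue_measurable; exact: borel_measurable_dist_lt.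
pose P := mass rho y0.
have PK v : 0 <= P v <= K.
  rewrite (radial_mass_ge0 mdens dens0 rhoK mshell).
  exact: (radial_mass_le mdens dens0 rhoK mshell).
have ndP : {homo P : u v / u <= v} by exact: (radial_mass_homo mdens dens0 rhoK mshell).
have [k kN Pk] := exists_scale_small_increment r0 PK NM.
pose a := r0 / 64 ^+ k / 4.
have p64 i : 0 < 64 ^+ i :> R by rewrite exprn_gt0.
have a0 : 0 < a by rewrite /a !divr_gt0.
have ar0 : 4 * a <= r0.
  have -> : 4 * a = r0 / 64 ^+ k by rewrite /a; field; rewrite gt_eqF.
  by rewrite ler_pdivrMr// ler_peMr ?(ltW r00)// exprn_ege1//; lra.
have da : r0 / 64 ^+ N / 4 <= a.
  rewrite /a ler_pM2r ?invr_gt0// ler_pM2l// lef_pV2 ?posrE//.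
  by apply: ler_weXn2l; [lra|exact: ltnW].
have Pa : P (4 * a) - P (a / 16) < M / 9.
  have -> : 4 * a = r0 / 64 ^+ k by rewrite /a; field; rewrite gt_eqF.
  have -> // : a / 16 = r0 / 64 ^+ k.+1.
  by rewrite /a exprS; field; rewrite gt_eqF.
have a30 : 0 < a / 3 by rewrite divr_gt0.
have [s s12 Hs] := exists_holder_point a a30 ndP.
have [s1 s2] := andP s12.
have sr : r0 / 64 ^+ N / 4 <= s <= r0 by apply/andP; split; lra.
have [x Xx xs] := hX s sr; have [y Yy ys] := hY s sr.
have s0 : 0 < s by lra.
have [w' [ws xw yw]] := exists_apex_direction (x - y0) (y - y0) n2 s0.
pose w := w' + y0.
have wE : w - y0 = w' by rewrite /w addrK.
have Hs' j : P (s + a / 3 * 9^-1 ^+ j) - P (s - a / 3 * 9^-1 ^+ j) <=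
    3^-1 ^+ j * (M / 9).
  apply: le_trans (Hs j) _; rewrite ler_wpM2l ?exprn_ge0// ?invr_ge0//.
  have h1 : P (a + 3 * (a / 3)) <= P (4 * a) by apply: ndP; lra.
  have h2 : P (a / 16) <= P a by apply: ndP; lra.
  by move: Pa; lra.
have M9 : 9 * (M / 9) <= M by lra.
have cone v : `|v - y0| = s -> s / 2 <= `|v - y0 + w'| ->
    cone_mass_le rho v w (a / 16) M.
  move=> vs vw; apply: (@cone_mass_le_radial v w y0 rho K a s (M / 9) M) => //.
  - by rewrite wE.
  - by rewrite wE.
  - exact: ltW.
have [z zw xyz] := apex a x y w rho a0 mrho rho0 (cone x xs xw) (cone y ys yw).
have leg v : `|v - y0| = s -> s / 2 <= `|v - y0 + w'| ->
    (forall t, 0 <= t <= 1 -> `|v + t *: (z - v) - y0| <= r0) /\ `|z - v| <= 6 * a.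
  move=> vs vw; split => [t t01|].
    have -> : v + t *: (z - v) - y0 = (v - y0) + t *: ((z - y0) - (v - y0)).
      by apply/rowP => i; rewrite !mxE; ring.
    have := @segment_avoids_center R n (v - y0) w' (z - y0) a s t a0.
    have zw' : `|z - y0 - w'| <= a / 16 by rewrite -wE opprB addrA subrK.
    case/(_ _ vs ws vw zw' t01)/andP; first by apply/andP; split; lra.
    by move=> _ /ltW/le_trans; apply.
  have -> : z - v = (z - w) + ((w - y0) - (v - y0)).
    by apply/rowP => i; rewrite !mxE; ring.
  have := ler_normD (z - w) ((w - y0) - (v - y0)).
  have := ler_normB (w - y0) (v - y0); rewrite vs wE ws.
  by move: zw; rewrite /cube/=; lra.
have [legx zx] := leg x xs xw; have [legy zy] := leg y ys yw.
exists x, y, z, a; split => //.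
by move=> t t01; split; [exact: legx|exact: legy].
Qed.

End ShortBrokenLine.

(** * Affine substitution on the line and the Euclidean norm *)

Section AffineSubstitution.
Context (R : realType).
Local Notation mu := (@lebesgue_measure R).
Local Notation aff a b :=
  (fun u : measurableTypeR R => (a * u + b : measurableTypeR R)%R).

Lemma measurable_real_affine (a b : R) : measurable_fun setT (aff a b).
Proof. by apply: measurable_funD => //; exact: measurable_funM. Qed.

Lemma lebesgue_measure_preimage_affine (a b : R) (A : set R) : a != 0 ->
  measurable A -> (`|a|%:E * mu (aff a b @^-1` A) = mu A)%E.
Proof.
move=> a0 mA.
have na0 : 0 <= `|a| by [].
pose push : {measure set measurableTypeR R -> \bar R} := pushforward mu (aff a b).
pose nu := push (measurable_real_affine a b).
pose k := NngNum na0.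
apply/esym; apply: (@lebesgue_measure_unique R (mscale k nu)) => //= _ [[p q]/= _ <-].
rewrite /mscale/= /pushforward.
have [ap|an|/eqP] := ltgtP a 0; last by rewrite (negbTE a0).
- rewrite (_ : _ @^-1` _ = `[(q - b) / a, (p - b) / a[%classic); last first.
    apply/seteqP; split => u /=; rewrite !in_itv/= ler_ndivrMr// ltr_ndivlMr//.
      by rewrite [u * a]mulrC lerBrDr ltrBlDr andbC.
    by rewrite [u * a]mulrC lerBrDr ltrBlDr andbC.
  rewrite !lebesgue_measure_itv/= !lte_fin ltr_nM2r ?invr_lt0// ltrD2r.
  case: ifP => _; last by rewrite mule0.
  by rewrite -!EFinB -EFinM ltr0_norm//; congr EFin; field.
- rewrite (_ : _ @^-1` _ = `](p - b) / a, (q - b) / a]%classic); last first.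
    apply/seteqP; split => u /=; rewrite !in_itv/= ler_pdivlMr// ltr_pdivrMr//.
      by rewrite [u * a]mulrC ltrBlDr lerBrDr.
    by rewrite [u * a]mulrC ltrBlDr lerBrDr.
  rewrite !lebesgue_measure_itv/= !lte_fin ltr_pM2r ?invr_gt0// ltrD2r.
  case: ifP => _; last by rewrite mule0.
  by rewrite -!EFinB -EFinM gtr0_norm//; congr EFin; field; rewrite gt_eqF.
Qed.

Lemma integral_comp_affine_le (a b : R) (E D : set R) (F : R -> \bar R) :
  a != 0 -> measurable E -> measurable D -> measurable_fun setT F ->
  (forall u, 0 <= F u)%E -> (forall u, E u -> D (a * u + b)) ->
  (\int[mu]_(u in E) F (a * u + b)%R <= `|a|^-1%:E * \int[mu]_(u in D) F u)%E.
Proof.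
move=> a0 mE mD mF F0 ED.
have na0 : 0 < `|a| by rewrite normr_gt0.
have maff := measurable_real_affine a b.
apply: (@le_trans _ _ (\int[mu]_(u in aff a b @^-1` D) F (a * u + b)%R)%E).
  apply: ge0_subset_integral => //.
  - by rewrite -[_ @^-1` _]setTI; exact: maff.
  - by apply: measurable_funTS; exact: (measurableT_comp mF maff).
pose push : {measure set measurableTypeR R -> \bar R} := pushforward mu (aff a b).
pose nu := push maff.
pose k := NngNum (ltW na0).
have mFD : measurable_fun D F by exact: measurable_funTS.
rewrite -(ge0_integral_pushforward maff mu mD mFD)//.
rewrite -[leLHS]mul1e -(mulVf (lt0r_neq0 na0)) EFinM -muleA lee_pmul2l//; last first.
  by rewrite lte_fin invr_gt0.
rewrite -[(`|a|)%:E]/(k%:num%:E).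
have /= <- := ge0_integral_mscale nu mD k mFD (fun x _ => F0 x).
rewrite le_eqVlt; apply/orP; left; apply/eqP.
apply: eq_measure_integral => A mA _.
exact: (lebesgue_measure_preimage_affine _ a0 mA).
Qed.

End AffineSubstitution.

Section EuclideanNorm.
Context (R : realType) (n : nat).
Implicit Types x y : 'rV[R]_n.

Lemma enorm_ge0 x : 0 <= enorm x.
Proof. exact: sqrtr_ge0. Qed.

Let sumsq_ge0 x : 0 <= \sum_(i < n) x 0 i ^+ 2.
Proof. by apply: sumr_ge0 => i _; exact: sqr_ge0. Qed.

Lemma sqr_enorm x : enorm x ^+ 2 = \sum_(i < n) x 0 i ^+ 2.
Proof. by rewrite sqr_sqrtr. Qed.

Lemma coord_le_enorm x i : `|x 0 i| <= enorm x.
Proof.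
rewrite -sqrtr_sqr ler_sqrt// (bigD1 i)//= lerDl.
by apply: sumr_ge0 => j _; exact: sqr_ge0.
Qed.

Lemma norm_le_enorm x : `|x| <= enorm x.
Proof. by apply/mx_norm_leP => [|i]; [exact: enorm_ge0|exact: coord_le_enorm]. Qed.

Lemma enorm_le_norm x : enorm x <= n%:R * `|x|.
Proof.
rewrite -(ler_pXn2r (n := 2))// ?nnegrE ?enorm_ge0 ?mulr_ge0// sqr_enorm.
apply: (@le_trans _ _ (\sum_(i < n) `|x| ^+ 2)).
  apply: ler_sum => i _; rewrite -[x 0 i ^+ 2]real_normK ?num_real//.
  by rewrite lerXn2r ?nnegrE// coord_le_norm.
rewrite sumr_const card_ord -[leLHS]mulr_natl exprMn ler_wpM2r ?sqr_ge0//.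
by rewrite -natrX ler_nat; case: (n) => // m; rewrite expnS leq_pmulr.
Qed.

Lemma enormZ (a : R) x : enorm (a *: x) = `|a| * enorm x.
Proof.
rewrite /enorm -sqrtr_sqr -sqrtrM ?sqr_ge0// mulr_sumr; congr Num.sqrt.
by apply: eq_bigr => i _; rewrite !mxE exprMn.
Qed.

Lemma enorm_eq0 x : enorm x = 0 -> x = 0.
Proof.
move=> x0; apply/rowP => i; rewrite mxE; apply/eqP; rewrite -normr_le0 -x0.
exact: coord_le_enorm.
Qed.

Lemma enormN x : enorm (- x) = enorm x.
Proof. by rewrite -scaleN1r enormZ normrN1 mul1r. Qed.

Lemma enorm0 : enorm (0 : 'rV[R]_n) = 0.
Proof. by rewrite -(scale0r 0) enormZ normr0 mul0r. Qed.

(** Cauchy-Schwarz inequality, from the nonnegativity of the squared norm of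
    |y| x - |x| y. *)
Lemma dot_le_enorm x y : \sum_(i < n) x 0 i * y 0 i <= enorm x * enorm y.
Proof.
have [y0|y0] := eqVneq (enorm y) 0.
  rewrite y0 mulr0 (enorm_eq0 y0) big1// => i _; by rewrite mxE mulr0.
have [x0|x0] := eqVneq (enorm x) 0.
  rewrite x0 mul0r (enorm_eq0 x0) big1// => i _; by rewrite mxE mul0r.
have yp : 0 < enorm y by rewrite lt_neqAle eq_sym y0 enorm_ge0.
have xp : 0 < enorm x by rewrite lt_neqAle eq_sym x0 enorm_ge0.
have : 0 <= \sum_(i < n) (enorm y * x 0 i - enorm x * y 0 i) ^+ 2.
  by apply: sumr_ge0 => i _; exact: sqr_ge0.
have -> : \sum_(i < n) (enorm y * x 0 i - enorm x * y 0 i) ^+ 2 =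
    enorm y ^+ 2 * (\sum_(i < n) x 0 i ^+ 2) + enorm x ^+ 2 * (\sum_(i < n) y 0 i ^+ 2)
    - 2 * (enorm x * enorm y) * \sum_(i < n) x 0 i * y 0 i.
  rewrite !mulr_sumr -big_split /= -sumrB; apply: eq_bigr => i _; ring.
rewrite -!sqr_enorm; set d := \sum_(i < n) _.
have -> : enorm y ^+ 2 * enorm x ^+ 2 + enorm x ^+ 2 * enorm y ^+ 2 -
  2 * (enorm x * enorm y) * d = 2 * (enorm x * enorm y) * (enorm x * enorm y - d) by ring.
by rewrite pmulr_rge0 ?subr_ge0// !mulr_gt0.
Qed.

Lemma ler_enormD x y : enorm (x + y) <= enorm x + enorm y.
Proof.
rewrite -(ler_pXn2r (n := 2))// ?nnegrE ?addr_ge0 ?enorm_ge0// sqr_enorm.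
have -> : \sum_(i < n) (x + y) 0 i ^+ 2 = \sum_(i < n) x 0 i ^+ 2 +
    \sum_(i < n) y 0 i ^+ 2 + 2 * \sum_(i < n) x 0 i * y 0 i.
  by rewrite mulr_sumr -!big_split /=; apply: eq_bigr => i _; rewrite mxE; ring.
by rewrite -!sqr_enorm; have := dot_le_enorm x y; lra.
Qed.

End EuclideanNorm.

(** * Arc length of broken lines *)

Section ArcLength.
Context (R : realType) (n : nat).
Local Notation V := 'rV[R]_n.
Implicit Types (c : R -> V).

Definition chord_sum c (a b : R) (s : seq R) : R :=
  \sum_(0 <= k < size s) enorm (c (nth b (a :: s) k.+1) - c (nth b (a :: s) k)).

Lemma chord_sum_cons c a b x s :
  chord_sum c a b (x :: s) = enorm (c x - c a) + chord_sum c x b s.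
Proof. by rewrite /chord_sum /= big_nat_recl. Qed.

Lemma chord_sum_le_arc_length c a b s : itv_partition a b s ->
  ((chord_sum c a b s)%:E <= arc_length c a b)%E.
Proof. by move=> abs; apply: ereal_sup_ubound; exists s. Qed.

Lemma chord_le_arc_length c a b : a <= b ->
  ((enorm (c b - c a))%:E <= arc_length c a b)%E.
Proof.
rewrite le_eqVlt => /predU1P[->|ab]; last first.
  apply: le_trans (chord_sum_le_arc_length c (itv_partition1 ab)).
  by rewrite chord_sum_cons /chord_sum big_geq// addr0.
apply: le_trans (_ : (chord_sum c b b [::])%:E <= _)%E.
  by rewrite subrr enorm0 /chord_sum big_geq.
by apply: chord_sum_le_arc_length; split.
Qed.

(** A path on [0, L] made of two straight pieces run at unit speed, with a
    corner at time m; either piece may be reduced to a point. *)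
Definition unit_speed_around (m L : R) c : Prop :=
  [/\ 0 <= m <= L,
      (forall s t, 0 <= s -> s <= t -> t <= m -> enorm (c t - c s) = t - s) &
      (forall s t, m <= s -> s <= t -> t <= L -> enorm (c t - c s) = t - s)].

Section UnitSpeed.
Variables (m L : R) (c : R -> V) (uc : unit_speed_around m L c).

Lemma unit_speed_lipschitz s t : 0 <= s -> s <= t -> t <= L ->
  enorm (c t - c s) <= t - s.
Proof.
case: uc => /andP[m0 mL] c1 c2 s0 st tL.
have [tm|/ltW mt] := leP t m; first by rewrite c1.
have [/ltW sm|ms] := ltP s m; last by rewrite c2.
rewrite -(subrKA (c m)) (le_trans (ler_enormD _ _))// (c1 s m)// (c2 m t)//.
by rewrite subrKA.
Qed.

(** The path is 1-Lipschitz, and a partition containing the corner attains the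
    bound. *)
Lemma arc_length_unit_speed a b : 0 <= a -> a <= b -> b <= L ->
  arc_length c a b = (b - a)%:E.
Proof.
case: (uc) => /andP[m0 mL] c1 c2 a0 ab bL.
apply/eqP; rewrite eq_le; apply/andP; split.
  apply: ge_ereal_sup => _ [s abs <-]; rewrite lee_fin -/(chord_sum c a b s).
  elim: s a a0 ab abs => [|x s IH] a a0 ab abs.
    by rewrite /chord_sum big_geq// subr_ge0.
  have [/andP[ax _] _] := abs.
  have xs := itv_partition_cons abs.
  have xb := itv_partition_le xs.
  rewrite chord_sum_cons.
  have := IH x (le_trans a0 (ltW ax)) xb xs.
  have := unit_speed_lipschitz a0 (ltW ax) (le_trans xb bL).
  by lra.
have [bm|mb] := leP b m; first by rewrite -c1//; exact: chord_le_arc_length.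
have [am|ma] := ltP a m; last by rewrite -c2//; exact: chord_le_arc_length.
apply: (@le_trans _ _ (chord_sum c a b [:: m; b])%:E).
  rewrite !chord_sum_cons /chord_sum big_geq// addr0.
  rewrite (c1 a m) ?(ltW am)// (c2 m b) ?(ltW mb)//.
  by rewrite lee_fin; lra.
by apply: chord_sum_le_arc_length; rewrite /itv_partition/= am mb eqxx.
Qed.

Lemma arc_param_unit_speed a b u : 0 <= a -> b <= L -> 0 <= u <= b - a ->
  arc_param c a b u = c (a + u).
Proof.
move=> a0 bL /andP[u0 ub]; congr c; apply: xget_unique.
  split; first by apply/andP; split; lra.
  by rewrite arc_length_unit_speed//; [congr EFin; ring|lra|lra].
move=> t [/andP[at_ tb]]; rewrite arc_length_unit_speed//; last exact: le_trans bL.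
by case=> <-; ring.
Qed.

End UnitSpeed.

(** The broken line from x to y through z, parametrized by arc length. Only
    parameters between 0 and the total length matter; a leg of length 0 is
    harmless since division by 0 gives 0. *)
Definition broken_line (x z y : V) (u : R) : V :=
  if u <= enorm (z - x) then x + (u / enorm (z - x)) *: (z - x)
  else y + ((enorm (z - x) + enorm (z - y) - u) / enorm (z - y)) *: (z - y).

Lemma enorm_div_self (v : V) : (enorm v / enorm v) *: v = v.
Proof.
have [v0|v0] := eqVneq (enorm v) 0; first by rewrite (enorm_eq0 v0) scaler0.
by rewrite divff ?scale1r.
Qed.

Section BrokenLine.
Variables (x z y : V).
Local Notation l1 := (enorm (z - x)).
Local Notation l2 := (enorm (z - y)).
Local Notation c := (broken_line x z y).

Lemma broken_line_first u : u <= l1 -> c u = x + (u / l1) *: (z - x).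
Proof. by rewrite /broken_line => ->. Qed.

Lemma broken_line_second u : l1 <= u ->
  c u = y + ((l1 + l2 - u) / l2) *: (z - y).
Proof.
rewrite le_eqVlt => /predU1P[<-|]; last by rewrite ltNge /broken_line => /negbTE ->.
rewrite /broken_line lexx enorm_div_self addrAC subrr add0r enorm_div_self.
by rewrite ![_ + (z - _)]addrC !subrK.
Qed.

Lemma broken_line_start : c 0 = x.
Proof. by rewrite broken_line_first ?enorm_ge0// mul0r scale0r addr0. Qed.

Lemma broken_line_end : c (l1 + l2) = y.
Proof.
by rewrite broken_line_second ?lerDl ?enorm_ge0// subrr mul0r scale0r addr0.
Qed.

Let div_norm (d : R) (v : V) : 0 <= d -> d <= enorm v ->
  enorm ((d / enorm v) *: v) = d.
Proof.
move=> d0 dv; have [v0|v0] := eqVneq (enorm v) 0.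
  have -> : d = 0 by apply/eqP; rewrite eq_le d0 andbT -v0.
  by rewrite mul0r scale0r enorm0.
by rewrite enormZ ger0_norm ?divr_ge0 ?enorm_ge0// divfK.
Qed.

Lemma broken_line_unit_speed : unit_speed_around l1 (l1 + l2) c.
Proof.
split; first by rewrite enorm_ge0 lerDl enorm_ge0.
  move=> s t s0 st tl; rewrite !broken_line_first ?(le_trans st)//.
  rewrite opprD addrACA subrr add0r -scalerBl -mulrBl div_norm ?subr_ge0//.
  by rewrite (le_trans _ tl)// gerBl.
move=> s t sl st tl; rewrite !broken_line_second// ?(le_trans sl)//.
rewrite opprD addrACA subrr add0r -scalerBl -mulrBl -enormN -scaleNr -mulNr.
rewrite div_norm; first by ring.
  by lra.
by lra.
Qed.

Lemma broken_line_segments u : 0 <= u <= l1 + l2 ->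
  exists2 t, 0 <= t <= 1 & c u = x + t *: (z - x) \/ c u = y + t *: (z - y).
Proof.
have q01 (p q : R) : 0 <= p -> p <= q -> 0 <= p / q <= 1.
  move=> p0 pq; rewrite divr_ge0 ?(le_trans p0 pq)//=.
  have [q0|q0] := eqVneq q 0; first by rewrite q0 invr0 mulr0.
  by rewrite ler_pdivrMr ?mul1r// lt_neqAle eq_sym q0 (le_trans p0 pq).
move=> /andP[u0 uL]; have [ul|/ltW lu] := leP u l1.
  by exists (u / l1); [exact: q01|left; exact: broken_line_first].
exists ((l1 + l2 - u) / l2); first by apply: q01; lra.
by right; exact: broken_line_second.
Qed.

End BrokenLine.

Lemma measurable_along_segment (rho : V -> \bar R) (x z : V) :
  measurable_fun [set: borelRn R n] (rho : borelRn R n -> \bar R) ->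
  measurable_fun [set: R] (fun t => rho (x + t *: (z - x))).
Proof.
move=> mrho; apply: (measurableT_comp mrho).
apply: (@measurable_rV R n _ R (fun t => x + t *: (z - x))) => i.
rewrite (_ : (fun _ => _) = fun t : R => x 0 i + t * (z 0 i - x 0 i)).
  by apply: measurable_segment_coord.
by apply/funext => t; rewrite !mxE.
Qed.

Lemma measurable_broken_line (x z y : V) :
  measurable_fun [set: R] (broken_line x z y : R -> borelRn R n).
Proof.
apply: measurable_rV => i.
pose l1 := enorm (z - x); pose l2 := enorm (z - y).
rewrite (_ : (fun _ => _) = fun u : R => if u <= l1
    then (l1^-1 * (z 0 i - x 0 i)) * u + x 0 i
    else (- l2^-1 * (z 0 i - y 0 i)) * u +
         (y 0 i + (l1 + l2) / l2 * (z 0 i - y 0 i))); last first.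
  apply/funext => u; rewrite /broken_line -/l1 -/l2; case: ifP => _.
    by rewrite !mxE; ring.
  by rewrite !mxE; ring.
apply: measurable_fun_ifT; first exact: measurable_fun_ler.
  exact: measurable_affine_comp.
exact: measurable_affine_comp.
Qed.

Lemma unit_speed_broken_line_eq (x z y : V) (c : R -> V)
    (l1 := enorm (z - x)) (l2 := enorm (z - y)) :
  (forall u, 0 <= u <= l1 + l2 -> c u = broken_line x z y u) ->
  unit_speed_around l1 (l1 + l2) c.
Proof.
move=> cE; have l10 : 0 <= l1 by exact: enorm_ge0.
have l20 : 0 <= l2 by exact: enorm_ge0.
have [h0 h1 h2] := broken_line_unit_speed x z y.
split => // s t ? ? ?; rewrite !cE; try (apply/andP; split; lra).
  exact: h1.
exact: h2.
Qed.

(** Split the parameters at the corner and substitute, on each leg, the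
    parameter t of the segment issued from its end point x or y. *)
Lemma arc_integral_broken_line_le (rho : V -> \bar R) (x z y : V) (c : R -> V)
    (a b : R) (l1 := enorm (z - x)) (l2 := enorm (z - y)) :
  measurable_fun [set: borelRn R n] (rho : borelRn R n -> \bar R) ->
  (forall v, 0 <= rho v)%E ->
  (forall u, 0 <= u <= l1 + l2 -> c u = broken_line x z y u) ->
  0 <= a -> a <= b -> b <= l1 + l2 ->
  (arc_integral rho c a b <=
    l1%:E * segment_integral rho x z + l2%:E * segment_integral rho y z)%E.
Proof.
move=> mrho rho0 cE a0 ab bL.
have l10 : 0 <= l1 by exact: enorm_ge0.
have l20 : 0 <= l2 by exact: enorm_ge0.
have uc := unit_speed_broken_line_eq cE.
pose mu := @lebesgue_measure R.
pose G u := rho (broken_line x z y (a + u)).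
have mG : measurable_fun [set: R] G.
  apply: (measurableT_comp mrho).
  apply: (measurableT_comp (measurable_broken_line x z y)).
  exact: measurable_funD.
have G0 u : (0 <= G u)%E by exact: rho0.
have seg0 w v : (0 <= segment_integral rho w v)%E.
  by apply: integral_ge0 => t _; exact: rho0.
have seg_cc w v : (\int[mu]_(t in `[0%R, 1%R]%classic) rho (w + t *: (v - w))%R =
    segment_integral rho w v)%E.
  rewrite /segment_integral -integral_itv_obnd_cbnd//.
  by apply: measurable_funTS; exact: measurable_along_segment.
have -> : arc_integral rho c a b = (\int[mu]_(u in `[0%R, (b - a)%R]%classic) G u)%E.
  rewrite /arc_integral (arc_length_unit_speed uc)//=.
  apply: eq_integral => u; rewrite inE/= in_itv/= => ub.
  rewrite (arc_param_unit_speed uc)// cE//.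
  by move: ub => /andP[? ?]; apply/andP; split; lra.
(* Without its last point, the interval contributes nothing to a leg of length
   0, for which the substitution would be singular. *)
rewrite -integral_itv_bndo_bndc; last exact: measurable_funTS.
pose I : set R := `[0%R, (b - a)%R[%classic.
pose E1 : set R := I `&` `]-oo, (l1 - a)%R[%classic.
pose E2 : set R := I `&` `[(l1 - a)%R, +oo[%classic.
have mE1 : measurable E1 by apply: measurableI; exact: measurable_itv.
have mE2 : measurable E2 by apply: measurableI; exact: measurable_itv.
have E1P u : E1 u -> [/\ 0 <= u, a + u < b & a + u < l1].
  by rewrite /E1 /I /= !in_itv/= => -[/andP[u0 ub] ul]; split => //; lra.
have E2P u : E2 u -> [/\ 0 <= u, a + u < b & l1 <= a + u].
  by rewrite /E2 /I /= !in_itv/= andbT => -[/andP[u0 ub] ul]; split => //; lra.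
have IE : I = E1 `|` E2.
  rewrite /E1 /E2 -setIUr; apply/seteqP; split => u /=; last by case.
  move=> Iu; split=> //; rewrite !in_itv/= andbT.
  by have [?|?] := ltP u (l1 - a); [left|right].
rewrite -/I IE ge0_integral_setU//; last 2 first.
- exact: measurable_funTS.
- rewrite disj_set2E; apply/eqP; rewrite -subset0 => u [/E1P[_ _ h1] /E2P[_ _ h2]].
  by move: h1; rewrite ltNge h2.
have m01 : measurable (`[0, 1]%classic : set R) by exact: measurable_itv.
apply: leeD.
- have [l1z|l1z] := eqVneq l1 0.
    rewrite (_ : E1 = set0) ?integral_set0 ?mule_ge0 ?lee_fin//.
    rewrite -subset0 => u /E1P[u0 _]; rewrite l1z; lra.
  have l1p : 0 < l1 by rewrite lt_neqAle eq_sym l1z.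
  pose Fx t := rho (x + t *: (z - x)).
  apply: (@le_trans _ _ (\int[mu]_(u in E1) Fx (l1^-1 * u + a / l1)%R)%E).
    rewrite le_eqVlt; apply/orP; left; apply/eqP; apply: eq_integral => u.
    rewrite inE => /E1P[_ _ /ltW ul]; rewrite /G broken_line_first// /Fx.
    by congr (rho (_ + _ *: _)); rewrite -/l1; ring.
  have l1V : l1^-1 != 0 by rewrite invr_eq0.
  have := @integral_comp_affine_le R l1^-1 (a / l1) E1 `[0, 1]%classic Fx l1V
    mE1 m01 (measurable_along_segment x z mrho) (fun t => rho0 _).
  rewrite gtr0_norm ?invr_gt0// invrK [X in (_ * X)%E](seg_cc x z); apply.
  move=> u /E1P[u0 _ ul]; rewrite /= in_itv/= mulrC -mulrDl.
  by rewrite divr_ge0 ?addr_ge0//= ler_pdivrMr// mul1r addrC ltW.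
- have [l2z|l2z] := eqVneq l2 0.
    rewrite (_ : E2 = set0) ?integral_set0 ?mule_ge0 ?lee_fin//.
    by rewrite -subset0 => u /E2P[u0 ub ul]; move: bL; rewrite l2z; lra.
  have l2p : 0 < l2 by rewrite lt_neqAle eq_sym l2z.
  pose Fy t := rho (y + t *: (z - y)).
  apply: (@le_trans _ _
      (\int[mu]_(u in E2) Fy (- l2^-1 * u + (l1 + l2 - a) / l2)%R)%E).
    rewrite le_eqVlt; apply/orP; left; apply/eqP; apply: eq_integral => u.
    rewrite inE => /E2P[_ _ ul]; rewrite /G broken_line_second// /Fy.
    by congr (rho (_ + _ *: _)); rewrite -/l1 -/l2; ring.
  have l2V : - l2^-1 != 0 by rewrite oppr_eq0 invr_eq0.
  have := @integral_comp_affine_le R (- l2^-1) ((l1 + l2 - a) / l2) E2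
    `[0, 1]%classic Fy l2V mE2 m01 (measurable_along_segment y z mrho)
    (fun t => rho0 _).
  rewrite normrN gtr0_norm ?invr_gt0// invrK [X in (_ * X)%E](seg_cc y z); apply.
  move=> u /E2P[u0 ub ul]; rewrite /= in_itv/= mulNr mulrC -mulNr -mulrDl.
  by rewrite divr_ge0 ?ler_pdivrMr//=; lra.
Qed.

Lemma path_integral_broken_line_le (rho : V -> \bar R) (x z y : V) (c : R -> V)
    (l1 := enorm (z - x)) (l2 := enorm (z - y)) :
  measurable_fun [set: borelRn R n] (rho : borelRn R n -> \bar R) ->
  (forall v, 0 <= rho v)%E ->
  (forall u, 0 <= u <= l1 + l2 -> c u = broken_line x z y u) ->
  (path_integral rho (`[0%R, (l1 + l2)%R], c) <=
    l1%:E * segment_integral rho x z + l2%:E * segment_integral rho y z)%E.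
Proof.
move=> mrho rho0 cE; apply: ge_ereal_sup => _ [[a b] /= [ab ain bin] <-].
move: ain bin; rewrite !in_itv/= => /andP[a0 _] /andP[_ bL].
exact: arc_integral_broken_line_le.
Qed.

Lemma locally_rectifiable_broken_line (x z y : V) (c : R -> V)
    (l1 := enorm (z - x)) (l2 := enorm (z - y)) :
  (forall u, 0 <= u <= l1 + l2 -> c u = broken_line x z y u) ->
  locally_rectifiable (`[0%R, (l1 + l2)%R], c).
Proof.
move=> cE a b /= ab; rewrite !in_itv/= => /andP[a0 aL] /andP[b0 bL].
by rewrite (arc_length_unit_speed (unit_speed_broken_line_eq cE)) ?ltry.
Qed.

End ArcLength.

(** * Images of rays under a homeomorphism *)

Section Topology.
Context (R : realType) (n : nat).
Local Notation V := 'rV[R]_n.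

Lemma within_continuous_comp_into (T U W : topologicalType) (A : set T)
    (D : set U) (c : T -> U) (f : U -> W) :
  {within A, continuous c} -> (forall t, A t -> D (c t)) ->
  {within D, continuous f} -> {within A, continuous (f \o c)}.
Proof.
move=> /subspace_continuousP cc AD /subspace_continuousP cf.
apply/subspace_continuousP => t At.
apply: cvg_comp (cf _ (AD t At)) => P /= wP.
have := cc t At _ wP; rewrite /nbhs/= /within/=.
by apply: filterS => s cs As; apply: cs => //; exact: AD.
Qed.

Lemma continuous_line (p v : V) : continuous (fun t : R => p + t *: v).
Proof.
move=> t; apply: cvgD; first exact: cvg_cst.
by apply: cvgZr_tmp; exact: cvg_id.
Qed.

Lemma compact_cube (x : V) (r : R) : compact (cube x r).
Proof.
apply: bounded_closed_compact; last exact: closed_cube.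
exists (`|x| + r); split; first exact: num_real.
move=> M xM z zx; rewrite /= ltW// (le_lt_trans _ xM)//.
rewrite -[z](subrK x) addrC (le_trans (ler_normD _ _))// lerD2l.
exact: zx.
Qed.

(** Otherwise the part of the ray before its first exit from D lies in the image
    by g of the cube, a compact subset of D. Its end point then lies in D as well,
    and the ray stays in D a little longer. *)
Lemma ray_image_leaves_cube (D D' : set V) (f g : V -> V) (p v y0 : V) (r : R) :
  open D -> compact (closure D) -> homeo_with_inverse D D' f g ->
  D p -> v != 0 -> cube y0 r `<=` D' ->
  exists2 T : R, 0 <= T &
    (forall t, 0 <= t <= T -> D (p + t *: v)) /\ r < `|f (p + T *: v) - y0|.
Proof.
move=> oD cD [[fD gD'] [gf fg] cf cg] Dp v0 rD'; apply: contrapT => stay.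
pose S := [set T : R | 0 <= T /\ forall t, 0 <= t <= T -> D (p + t *: v)].
have S0 : S 0.
  split => // t; rewrite -eq_le => /eqP <-.
  by rewrite scale0r addr0.
have inS T : S T -> `|f (p + T *: v) - y0| <= r.
  by move=> [T0 DT]; rewrite leNgt; apply/negP => h; apply: stay; exists T.
have vp : 0 < `|v| by rewrite normr_gt0.
have [B Bp] : exists B, forall z, D z -> `|z| <= B.
  have [M [_ MD]] := compact_bounded cD.
  by exists (M + 1) => z Dz; apply: (MD (M + 1)); [rewrite ltrDl|exact: subset_closure].
have ubS : ubound S ((B + `|p|) / `|v|).
  move=> T [T0 DT]; rewrite ler_pdivlMr//.
  have := Bp _ (DT T _); rewrite lexx T0 => /(_ isT) h.
  rewrite -[X in X * _]ger0_norm// -normrZ -[T *: v](addKr p).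
  by rewrite (le_trans (ler_normD _ _))// normrN addrC lerD2r.
have supS : has_sup S by split; [exists 0|exists ((B + `|p|) / `|v|)].
pose T := sup S.
have T0 : 0 <= T by exact: sup_upper_bound.
have lineT B' : nbhs (p + T *: v) B' ->
    exists2 e, 0 < e & forall t, `|T - t| < e -> B' (p + t *: v).
  move=> nB; have /nbhs_ballP[e e0 eB] := @continuous_line p v T _ nB.
  by exists e => // t Tt; apply: eB.
pose C := g @` cube y0 r.
have CD : C `<=` D by move=> _ [y yr <-]; apply: gD'; exact: rD'.
have cC : closed C.
  apply: compact_closed; first exact: norm_hausdorff.
  apply: continuous_compact; last exact: compact_cube.
  exact: continuous_subspaceW rD' cg.
have SC t : S t -> C (p + t *: v).
  move=> St; have [t0 Dt] := St.
  exists (f (p + t *: v)); first exact: inS.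
  by rewrite gf//; apply: Dt; rewrite t0 lexx.
have DT : D (p + T *: v).
  apply/CD/cC => B' /lineT[e e0 eB].
  have [t St] := sup_adherent e0 supS; rewrite -/T => Tt.
  have tT : t <= T by exact: sup_upper_bound.
  exists (p + t *: v); split; first exact: SC.
  by apply: eB; rewrite ger0_norm ?subr_ge0//; lra.
have [e e0 eD] : exists2 e, 0 < e & forall t, `|T - t| < e -> D (p + t *: v).
  by apply: lineT; exact: open_nbhs_nbhs.
have : S (T + e / 2).
  split; first by lra.
  move=> t /andP[t0 tTe]; have [tT|Tt] := ltP t T.
    have Tt0 : 0 < T - t by rewrite subr_gt0.
    have [t' [_ St']] := sup_adherent Tt0 supS; rewrite -/T subKr => tt'.
    by apply: St'; rewrite t0 ltW.
  by apply: eD; rewrite ler0_norm ?subr_le0//; lra.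
by move=> /(sup_upper_bound supS); rewrite -/T; lra.
Qed.

(** Intermediate value theorem along the part of the ray just found. *)
Lemma ray_image_meets_spheres (D D' : set V) (f g : V -> V) (p v y0 : V) (r : R) :
  open D -> compact (closure D) -> homeo_with_inverse D D' f g ->
  D p -> v != 0 -> cube y0 r `<=` D' ->
  forall s, `|f p - y0| <= s <= r ->
  exists2 t : R, 0 <= t & D (p + t *: v) /\ `|f (p + t *: v) - y0| = s.
Proof.
move=> oD cD hfg Dp v0 rD' s /andP[ps sr].
have [T T0 [DT rT]] := ray_image_leaves_cube oD cD hfg Dp v0 rD'.
have [_ _ cf _] := hfg.
pose h t := `|f (p + t *: v) - y0|.
have ch : {within `[0, T], continuous h}.
  have cfl : {within `[0, T], continuous (f \o (fun t : R => p + t *: v))}.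
    apply: within_continuous_comp_into cf.
      exact/continuous_subspaceT/continuous_line.
    by move=> t /=; rewrite in_itv/=; exact: DT.
  move=> t; apply: (@cvg_norm _ V); apply: cvgB; last exact: cvg_cst.
  exact: cfl.
have h0 : h 0 = `|f p - y0| by rewrite /h scale0r addr0.
have [t tT hs] : exists2 c, c \in `[0, T] & h c = s.
  have hle : h 0 <= h T by rewrite h0 (le_trans ps)// (le_trans sr)// ltW.
  apply: IVT => //.
  by rewrite min_l// max_r// h0 ps (le_trans sr)// ltW.
move: tT; rewrite in_itv/= => /andP[t0 tT].
by exists t => //; split => //; apply: DT; rewrite t0.
Qed.

End Topology.

Section Admissibility.
Context (R : realType) (n : nat).
Local Notation V := 'rV[R]_n.

(** Paths joining two rays that point away from each other, with origins at
    distance at least e, are among them, and the constant 1 / e is admissible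
    for the whole family. *)
Definition far_paths (D : set V) (e : R) : set (rpath R n) :=
  [set c | path_in D c /\ exists t1 t2, [/\ t1 \in c.1, t2 \in c.1 &
    e <= enorm (c.2 t2 - c.2 t1)]].

Lemma adm_far_paths (D : set V) (e : R) : 0 < e ->
  adm (far_paths D e) (cst (e^-1)%:E).
Proof.
move=> e0; split => [x|/=|c [_ [t1 [t2 [t1c t2c ec]]]] rc].
- by rewrite lee_fin invr_ge0 ltW.
- exact: measurable_cst.
wlog t12 : t1 t2 t1c t2c ec / t1 <= t2.
  move=> wl; have [|/ltW] := leP t1 t2; first exact: wl.
  by apply: wl => //; rewrite -enormN opprB.
apply: (@le_trans _ _ (arc_integral (cst (e^-1)%:E) c.2 t1 t2)); last first.
  by apply: ereal_sup_ubound; exists (t1, t2).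
have lfin := rc _ _ t12 t1c t2c.
have el : (e%:E <= arc_length c.2 t1 t2)%E.
  by apply: le_trans (chord_le_arc_length _ t12); rewrite lee_fin.
have lE : (arc_length c.2 t1 t2 = (fine (arc_length c.2 t1 t2))%:E)%E.
  by rewrite fineK// ge0_fin_numE// (le_trans _ el)// lee_fin ltW.
rewrite /arc_integral; move: el; rewrite {}lE; set l := fine _ => /=.
rewrite lee_fin => el.
rewrite integral_cst; last exact: measurable_itv.
rewrite /= lebesgue_measure_itv/= lte_fin (lt_le_trans e0 el) sube0 -EFinM lee_fin.
by rewrite mulrC ler_pdivlMr// mul1r.
Qed.

End Admissibility.

(** * Equicontinuity *)

Section MainEstimate.
Context (R : realType) (n : nat).
Local Notation V := 'rV[R]_n.

Lemma modulus_lt_adm (Gamma : set (rpath R n)) (K : R) :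
  (modulus Gamma < K%:E)%E -> exists2 rho, adm Gamma rho &
    (\int[lebesgue R n]_x (rho x ^+ n) <= K%:E)%E.
Proof. by move=> /ereal_inf_lt[_ [rho arho <-] /ltW rK]; exists rho. Qed.

Lemma integral_weight_cst_fin (D : set V) (Q : V -> \bar R) (k : R) :
  measurable (D : set (lebesgueRn R n)) -> 0 <= k ->
  (lebesgue R n).-integrable D Q ->
  (\int[lebesgue R n]_(x in D) (Q x * (cst k%:E x : \bar R) ^+ n) < +oo)%E.
Proof.
move=> mD k0 iQ.
have [r ->] : exists r : R, (\int[lebesgue R n]_(x in D)
    (Q x * (cst k%:E x : \bar R) ^+ n) = r%:E)%E.
  under eq_integral do rewrite /cst/= -EFin_expe.
  rewrite integralZr//.
  exists (fine (\int[lebesgue R n]_(x in D) Q x) * k ^+ n).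
  by rewrite EFinM fineK// integrable_fin_num.
by rewrite ltry.
Qed.

Lemma broken_line_image_path (D D' : set V) (f g : V -> V) (x y z : V)
    (L := enorm (z - x) + enorm (z - y)) :
  homeo_with_inverse D D' f g ->
  (forall t, 0 <= t <= 1 -> D' (x + t *: (z - x)) /\ D' (y + t *: (z - y))) ->
  path_in D (`[0, L], g \o broken_line x z y).
Proof.
move=> [[_ gD'] _ _ cg] segD'.
have L0 : 0 <= L by rewrite addr_ge0 ?enorm_ge0.
have inD' u : 0 <= u <= L -> D' (broken_line x z y u).
  by move=> /broken_line_segments[t t01 []->]; have [] := segD' t t01.
split; last by move=> t /=; rewrite in_itv/= => tL; apply: gD'; exact: inD'.
split; first by exists 0; rewrite /= in_itv/= lexx.
apply: within_continuous_comp_into cg; last first.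
  by move=> t /=; rewrite in_itv/=; exact: inD'.
have us := broken_line_unit_speed x z y; rewrite -/L in us.
apply/subspace_continuousP => t /=; rewrite in_itv/= => /andP[t0 tL].
apply/cvgrPdist_lt => e e0.
apply: filterS (nbhsx_ballx t e e0) => s tse; rewrite /= in_itv/= => /andP[s0 sL].
apply: le_lt_trans (norm_le_enorm _) _.
have [st|/ltW ts] := leP s t.
  apply: le_lt_trans (unit_speed_lipschitz us s0 st tL) _.
  by rewrite (le_lt_trans (ler_norm _)).
rewrite -enormN opprB.
apply: le_lt_trans (unit_speed_lipschitz us t0 ts sL) _.
by rewrite (le_lt_trans (ler_norm _))// distrC.
Qed.

End MainEstimate.

Theorem theorem1p1 (R : realType) (n : nat) (hn : (2 <= n)%N)
    (D D' : set 'rV[R]_n) (domD : domain D) (domD' : domain D')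
    (compD : compact (closure D)) (compD' : compact (closure D'))
    (Q : 'rV[R]_n -> \bar R)
    (Q_ge0 : forall x, (0 <= Q x)%E)
    (mQ : measurable_fun [set: lebesgueRn R n] (Q : lebesgueRn R n -> \bar R))
    (Q_ge1 : forall x, D x -> (1 <= Q x)%E)
    (Q_out : forall x, ~ D x -> Q x = 0%E)
    (Q_L1 : (lebesgue R n).-integrable D Q) :
  equicontinuous_in D' (R_Q Q D D').
Proof.
move=> y0 D'y0 e e0.
have [_ oD _] := domD; have [_ oD' _] := domD'.
have [r r0 rD'] : exists2 r, 0 < r & cube y0 r `<=` D'.
  have /nbhs_ballP[r /= r0 rD'] : nbhs y0 D' by exact: open_nbhs_nbhs.
  exists (r / 2); first by rewrite divr_gt0.
  move=> z zr; apply: rD'; rewrite -ball_normE /ball_/= distrC.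
  by apply: le_lt_trans zr _; rewrite ltr_pdivrMr// ltr_pMr//; lra.
have mD : measurable (D : set (lebesgueRn R n)).
  by apply: borel_lebesgue_measurable; exact: open_measurable_borelRn.
have ei0 : 0 <= e^-1 by rewrite invr_ge0 ltW.
pose I := (\int[lebesgue R n]_(x in D) (Q x * (cst (e^-1)%:E x : \bar R) ^+ n))%E.
have Ifin : (I < +oo)%E by exact: integral_weight_cst_fin.
have I0 : (0 <= I)%E.
  by apply: integral_ge0 => x _; rewrite mule_ge0// expe_ge0// lee_fin.
have IE : I = (fine I)%:E by rewrite fineK// ge0_fin_numE.
pose K := fine I + 1.
have K0 : 0 <= K by rewrite addr_ge0// fine_ge0.
(* Up to here nothing depends on a member of the family, so neither does d. *)
have [d d0 short] := @exists_short_broken_line R n K r hn K0 r0.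
exists d => // g [f [hfg modf]] y1 D'y1 y1d; rewrite ltNge; apply/negP => far.
have [[fD gD'] [gf fg] _ _] := hfg.
(* The rays issued from g y1 and g y0 in the directions v and - v never get
   closer to each other than their origins. *)
pose v := g y1 - g y0.
have v0 : v != 0.
  by apply: contraTneq far => v0; rewrite -/v v0 enorm0 -ltNge.
have [rho [rho0 mrho rho1] rhoK] : exists2 rho,
    adm (path_image f (far_paths D e)) rho &
    (\int[lebesgue R n]_x (rho x ^+ n) <= K%:E)%E.
  apply: modulus_lt_adm; apply: (@le_lt_trans _ _ I).
    by apply: modf; [move=> c []|exact: adm_far_paths].
  by rewrite IE lte_fin /K ltrDl.
pose X := [set x | exists2 t : R, 0 <= t & D (g y1 + t *: v) /\ x = f (g y1 + t *: v)].
pose Y := [set y | exists2 t : R, 0 <= t &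
  D (g y0 + t *: - v) /\ y = f (g y0 + t *: - v)].
have y1d' : `|y1 - y0| < d by apply: le_lt_trans (norm_le_enorm _) y1d.
have hX s : d <= s <= r -> exists2 x, X x & `|x - y0| = s.
  move=> /andP[ds sr].
  have [|t t0 [Dt fs]] := @ray_image_meets_spheres _ _ D D' f g (g y1) v y0 r
    oD compD hfg (gD' _ D'y1) v0 rD' s.
    by rewrite fg// sr (le_trans (ltW y1d') ds).
  by exists (f (g y1 + t *: v)) => //; exists t.
have nv0 : - v != 0 by rewrite oppr_eq0.
have hY s : d <= s <= r -> exists2 x, Y x & `|x - y0| = s.
  move=> /andP[ds sr].
  have [|t t0 [Dt fs]] := @ray_image_meets_spheres _ _ D D' f g (g y0) (- v) y0 r
    oD compD hfg (gD' _ D'y0) nv0 rD' s.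
    by rewrite fg// sr subrr normr0 (le_trans (ltW d0) ds).
  by exists (f (g y0 + t *: - v)) => //; exists t.
have [x [y [z [a [Xx Yy a0 seg [zx zy xyz]]]]]] :=
  short y0 X Y rho mrho rho0 rhoK hX hY.
have segD' t : 0 <= t <= 1 -> D' (x + t *: (z - x)) /\ D' (y + t *: (z - y)).
  by move=> /seg[? ?]; split; apply: rD'.
pose l1 := enorm (z - x); pose l2 := enorm (z - y).
have L0 : 0 <= l1 + l2 by rewrite addr_ge0 ?enorm_ge0.
pose c := broken_line x z y.
have path_c := broken_line_image_path hfg segD'.
have cE u : 0 <= u <= l1 + l2 -> (f \o (g \o c)) u = broken_line x z y u.
  move=> /broken_line_segments[t t01 h]; rewrite /= fg//.
  by rewrite /c; have [h1 h2] := segD' t t01; case: h => ->.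
have gxy : e <= enorm (g y - g x).
  have [t t0 [Dt ->]] := Xx; have [s s0 [Ds ->]] := Yy.
  rewrite !gf// -enormN opprB.
  have -> : g y1 + t *: v - (g y0 + s *: - v) = (1 + t + s) *: v.
    by rewrite /v; apply/rowP => i; rewrite !mxE; ring.
  rewrite enormZ ger0_norm ?addr_ge0// (le_trans far)// ler_peMl ?enorm_ge0//.
  by rewrite -addrA lerDl addr_ge0.
have Gc : path_image f (far_paths D e) (`[0, l1 + l2], f \o (g \o c)).
  exists (`[0, l1 + l2], g \o c) => //; split => //=.
  exists 0, (l1 + l2); rewrite !in_itv/= !lexx L0; split => //.
  by rewrite /c broken_line_start broken_line_end.
have := rho1 _ Gc (locally_rectifiable_broken_line cE).
apply/negP; rewrite -ltNge.
apply: le_lt_trans (path_integral_broken_line_le mrho rho0 cE) _.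
rewrite -/l1 -/l2.
have n0 : 0 < n%:R :> R by rewrite ltr0n (leq_trans _ hn).
have na0 : 0 < 6 * n%:R * a by rewrite !mulr_gt0.
have leg w : `|z - w| <= 6 * a -> enorm (z - w) <= 6 * n%:R * a.
  move=> zw; apply: le_trans (enorm_le_norm _) _.
  by rewrite -mulrA mulrCA ler_pM2l.
have seg0 w : (0 <= segment_integral rho w z)%E.
  by apply: integral_ge0 => t _; exact: rho0.
have legs (p q : \bar R) : (0 <= p -> 0 <= q ->
    l1%:E * p + l2%:E * q <= (6 * n%:R * a)%:E * (p + q))%E.
  move=> p0 q0; rewrite ge0_muleDr//.
  by apply: leeD; apply: lee_wpmul2r; rewrite // lee_fin leg.
apply: le_lt_trans (legs _ _ (seg0 x) (seg0 y)) _.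
by rewrite -lte_pdivlMl// mule1.
Qed.
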